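(* Consider the preferential attachment model with types described in the context. Assume that $z^*$ is the only fixed point of $R$ in $[0,1]$, except possibly for linearly unstable fixed points at $0$ and/or $1$. Suppose that the type assignment rule is such that $z\mapsto R(R(z))$ has a linearly stable fixed point $\tilde z\neq z^*$. Then for the community structure with two communities $S=\{1,2\}$ given by the attractiveness matrix $$A=\begin{pmatrix}0&1\\1&0\end{pmatrix}$$ and any $\mu_1,\mu_2>0$ with $\mu_1+\mu_2=1$, there is positive probability that there exist $z_1\neq z_2$ such that $Z^{(t)}_1\to z_1$ and $Z^{(t)}_2\to z_2$ as $t\to\infty$.
   Context: Model. $S=\{1,\dots,N\}$ is a finite set of communities, $m\ge 1$ is an integer, $\mu=(\mu_i)_{i\in S}$ is a probability distribution on $S$, and $A=(\alpha_{x,y})_{x,y\in S}$ (the attractiveness matrix) has non-negative entries with $\sum_x\alpha_{x,y}>0$ for every $y$. The type assignment rule is given by $p_0,\dots,p_m\in[0,1]$. $G_0$ is a fixed finite initial (multi)graph with $n_0$ vertices and $mn_0$ edges, all vertices having positive degree; each vertex $v$ has a community $c(v)\in S$ and a type (colour), red or blue, and each community contains at least one vertex of $G_0$. Given $G_t$, the graph $G_{t+1}$ is obtained by adding a vertex $v_{t+1}$ whose community $c(v_{t+1})$ has law $\mu$, independently of everything else, and $m$ edges from $v_{t+1}$ to $m$ existing vertices chosen independently with replacement, each choice being equal to vertex $v$ with probability $$\frac{\alpha_{c(v),c(v_{t+1})}\deg_{G_t}(v)}{\sum_{u\in V(G_t)}\alpha_{c(u),c(v_{t+1})}\deg_{G_t}(u)}.$$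 Then, conditional on exactly $k$ of the $m$ chosen neighbours (with multiplicity) being red, $v_{t+1}$ becomes red with probability $p_k$ and otherwise blue; types never change afterwards. $Z^{(t)}_i=\dfrac{\sum_{v\text{ red},\,c(v)=i}\deg_{G_t}(v)}{\sum_{v:\,c(v)=i}\deg_{G_t}(v)}$ is the proportion of edge-ends in community $i$ at time $t$ which are at red vertices. The polynomial of the rule is $R(z)=\sum_{k=0}^m\binom mk z^k(1-z)^{m-k}p_k$. For $f=R$ or $f=R\circ R$: a fixed point $z\in(0,1)$ of $f$ is stable if for some $\eta>0$, $f(y)>y$ for $y\in(z-\eta,z)$ and $f(y)<y$ for $y\in(z,z+\eta)$, and unstable if for some $\eta>0$, $f(y)<y$ for $y\in(z-\eta,z)$ and $f(y)>y$ for $y\in(z,z+\eta)$; for fixed points at $0$ or $1$ the same definitions are used with only the one-sided neighbourhood inside $[0,1]$. A stable fixed point is linearly stable if $f'(z)<1$; an unstable fixed point is linearly unstable if $f'(z)>1$. The assumption on $z^*$ means: $z^*\in[0,1]$ is a fixed point of $R$, and any other fixed point of $R$ in $[0,1]$ is at $0$ or $1$ and is linearly unstable.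
   Formalization: The formal theorem additionally assumes that G_0 has a red vertex if p_0 = 0 and a blue vertex if p_m = 1; otherwise all vertices keep one colour forever, Z_1 = Z_2 at all times, and the claim fails. *)

(* Defs.v *)
From HB Require Import structures.
From mathcomp Require Import all_boot all_order all_algebra.
From mathcomp Require Import all_classical all_reals all_analysis.

Set Implicit Arguments.
Unset Strict Implicit.
Unset Printing Implicit Defensive.

Import Order.TTheory GRing.Theory Num.Theory.
Import numFieldNormedType.Exports.

Local Open Scope classical_set_scope.
Local Open Scope ring_scope.

(* A finite multigraph with communities and types.  The first component lists
   (community, type) for each vertex, in order of arrival ([true] is red), and
   a vertex is its position in that list; the second component lists the
   edges as pairs of vertices. *)
Definition tgraph (N : nat) : countType :=
  (seq ('I_N * bool) * seq (nat * nat))%type.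

Notation vertex g := 'I_(size g.1).

Section Graphs.
Variables (R : realType) (N : nat).
Implicit Types (g : tgraph N).

Definition community g (v : vertex g) : 'I_N := (tnth (in_tuple g.1) v).1.

Definition is_red g (v : vertex g) : bool := (tnth (in_tuple g.1) v).2.

(* A loop contributes 2 to the degree. *)
Definition deg g (v : vertex g) : nat :=
  (\sum_(e <- g.2) ((e.1 == v :> nat) + (e.2 == v :> nat)))%N.

Record initial_graph (m : nat) g : Prop := InitialGraph {
  initial_edges : forall e, e \in g.2 ->
    (e.1 < size g.1)%N /\ (e.2 < size g.1)%N ;
  initial_size : size g.2 = (m * size g.1)%N ;
  initial_deg : forall v : vertex g, (0 < deg v)%N ;
  initial_community : forall i : 'I_N, exists v : vertex g, community v = i
}.

Definition red_proportion g (i : 'I_N) : R :=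
  (\sum_(v : vertex g | is_red v && (community v == i)) deg v)%N%:R /
  (\sum_(v : vertex g | community v == i) deg v)%N%:R.

(* [A x y] is the attractiveness of community [x] to a new vertex of
   community [y]. *)
Definition attach_prob (A : 'M[R]_N) g (y : 'I_N) (v : vertex g) : R :=
  A (community v) y * (deg v)%:R /
  \sum_(u : vertex g) A (community u) y * (deg u)%:R.

Definition step_prob (A : 'M[R]_N) (mu : 'I_N -> R) (m : nat) (p : nat -> R)
    g (y : 'I_N) (w : m.-tuple (vertex g)) (b : bool) : R :=
  let k := count (@is_red g) w in
  mu y * (\prod_(v <- w) attach_prob A y v) * (if b then p k else 1 - p k).

Definition add_vertex (m : nat) g (y : 'I_N) (w : m.-tuple (vertex g))
    (b : bool) : tgraph N :=
  (rcons g.1 (y, b), g.2 ++ [seq (size g.1, nat_of_ord v) | v <- w]).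

(* [G] is a realisation of the model started at [g0].  The last clause says
   that, conditionally on the whole history up to time [t], the next vertex
   has community [y], ordered choices of neighbours [w] and type [b] with
   probability [step_prob]; distinct triples [(y, w, b)] give distinct graphs
   [add_vertex y w b], as edges are recorded in order. *)
Record attachment_process d (T : measurableType d) (P : probability T R)
    (A : 'M[R]_N) (mu : 'I_N -> R) (m : nat) (p : nat -> R) (g0 : tgraph N)
    (G : nat -> T -> tgraph N) : Prop := AttachmentProcess {
  process_measurable : forall t g, measurable [set x | G t x = g] ;
  process_initial : forall x, G 0%N x = g0 ;
  process_step : forall (t : nat) (h : nat -> tgraph N) (y : 'I_N)
      (w : m.-tuple (vertex (h t))) (b : bool),
    let history := [set x | forall s, (s <= t)%N -> G s x = h s] in
    P (history `&` [set x | G t.+1 x = add_vertex y w b]) =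
    (P history * (step_prob A mu p y w b)%:E)%E
}.

(* Excludes exactly the starts from which the model is deterministically
   monochromatic for ever: all blue with [p 0 = 0], all red with [p m = 1]. *)
Definition not_absorbed (m : nat) (p : nat -> R) g : Prop :=
  (p 0%N = 0 -> exists v : vertex g, is_red v) /\
  (p m = 1 -> exists v : vertex g, ~~ is_red v).

End Graphs.

Section Stability.
Variable R : realType.
Implicit Types (f : {poly R}) (z : R).

Definition rule_poly (m : nat) (p : nat -> R) : {poly R} :=
  \sum_(k < m.+1) ('C(m, k)%:R * p k) *: ('X ^+ k * (1 - 'X) ^+ (m - k)).

Definition fixed_point f z : Prop := 0 <= z <= 1 /\ f.[z] = z.

(* Restricting [y] to [0, 1] gives the one-sided notion at 0 and 1, and makes
   no difference at interior points, where [eta] can be decreased. *)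
Definition stable f z : Prop :=
  fixed_point f z /\
  exists2 eta : R, 0 < eta &
    (forall y, 0 <= y <= 1 -> z - eta < y < z -> y < f.[y]) /\
    (forall y, 0 <= y <= 1 -> z < y < z + eta -> f.[y] < y).

Definition unstable f z : Prop :=
  fixed_point f z /\
  exists2 eta : R, 0 < eta &
    (forall y, 0 <= y <= 1 -> z - eta < y < z -> f.[y] < y) /\
    (forall y, 0 <= y <= 1 -> z < y < z + eta -> y < f.[y]).

Definition linearly_stable f z : Prop := stable f z /\ f^`().[z] < 1.

Definition linearly_unstable f z : Prop := unstable f z /\ 1 < f^`().[z].

Definition essentially_unique_fixed_point f (zstar : R) : Prop :=
  fixed_point f zstar /\
  forall z, fixed_point f z -> z <> zstar ->
    (z = 0 \/ z = 1) /\ linearly_unstable f z.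

End Stability.

(* Main.v *)
Require Import Defs.
From mathcomp Require Import all_boot all_order all_algebra.
From mathcomp Require Import all_classical all_reals all_analysis.
From mathcomp Require Import ring lra zify.

Set Implicit Arguments.
Unset Strict Implicit.
Unset Printing Implicit Defensive.

Import Order.TTheory GRing.Theory Num.Theory.
Import numFieldNormedType.Exports.

Local Open Scope classical_set_scope.
Local Open Scope ring_scope.

(**
Every new vertex chooses all its neighbours in the opposite community, so each
step adds exactly [m] edge-ends to both communities: the total degrees [D_i]
are deterministic and grow linearly, and only the red proportions [Z_i] are
random.  Writing [f] for the polynomial of the rule, their mean increments are
[m mu_i / (D_i + m) * (f(Z_j) - Z_i)], with [j] the community other than [i].
The pair [a = (f(ztilde), ztilde)] is therefore an equilibrium of the mean
flow, and its coordinates differ: a fixed point of [f] other than [zstar] has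
[f' > 1], so it cannot be linearly stable for [f o f] ([two_cycle_of_stable]).

_Stability_.  The linearised flow at [a] has negative trace and determinant
proportional to [1 - f'(a_0) f'(a_1) > 0].  A diagonal quadratic form
[V = sum_i q_i (Z_i - a_i)^2] already decreases along the flow near [a]
([lyapunov_weights], [local_drift]), which for the process says
[E V_(t+1) <= V_t - kap V_t / (t+1) + C / (t+1)^2]
([lyapunov_contraction]).  Multiplying by a slowly growing weight [w_t] turns
[w_t (V_t + 8 C / (t+1))] into a supermartingale as long as [w_t V_t < eps]
([weighted_decrease]).  The maximal inequality for nonnegative supermartingales
([stays_good_bound]) then shows that, from any start with
[V + 8 C / (t+1) < eps], there is positive probability that [w_t V_t < eps]
for ever; since [w_t] tends to infinity, this forces [Z_i --> a_i].  Confinement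
and convergence thus come out of one estimate ([local_convergence]).

_Reaching a good start_.  It remains to exhibit one finite history of positive
probability that ends late and close to [a].  If each community has vertices of
both colours, every number of red neighbours is possible at every step, and one
may choose the steps greedily: the mean step at [a] points exactly along the ray
through [a], so some possible step increases the squared distance to that ray by
no more than its variance ([greedy_step]); after [t] steps this distance is
of order [sqrt t], and [Z - a] of order [1 / sqrt t] ([reachable_near]).  Such a
two-coloured state can be reached unless the process is frozen with one
community all red and the other all blue ([interior_or_frozen]), and in that
case the proportions are constantly [0] and [1] ([frozen_limits]).
*)

(** * Binomial averages *)

Section Binomial.
Variable R : realType.
Implicit Types (phi : nat -> R) (z : R).

Lemma horner_rule_poly m phi z :
  (rule_poly m phi).[z] =
  \sum_(k < m.+1) 'C(m, k)%:R * z ^+ k * (1 - z) ^+ (m - k) * phi k.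
Proof.
rewrite /rule_poly horner_sum; apply: eq_bigr => k _.
by rewrite !hornerE /=; ring.
Qed.

(** The first of [m.+1] independent trials is a success with probability [z];
    on polynomials this is Pascal's rule. *)
Lemma rule_polyS m phi z :
  (rule_poly m.+1 phi).[z] =
  z * (rule_poly m (fun k => phi k.+1)).[z] + (1 - z) * (rule_poly m phi).[z].
Proof.
rewrite !horner_rule_poly big_ord_recl /=.
under eq_bigr => k _.
  rewrite /bump /= add1n binS natrD subSS !mulrDl.
  over.
rewrite big_split /= [X in _ + X]addrC addrCA; congr (_ + _); last first.
  rewrite [in RHS]big_ord_recl big_ord_recr /= ['C(m, m.+1)]bin_small // !mul0r addr0.
  rewrite mulrDr; congr (_ + _); first by rewrite !bin0 !subn0 exprS; ring.
  rewrite mulr_sumr; apply: eq_bigr => k _.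
  rewrite /bump /= !add1n.
  have -> : (m - k)%N = (m - k.+1).+1 by rewrite subnSK.
  by rewrite [_ ^+ (m - k.+1).+1]exprS; ring.
by rewrite mulr_sumr; apply: eq_bigr => k _; rewrite exprS; ring.
Qed.

Lemma rule_poly0 phi z : (rule_poly 0 phi).[z] = phi 0%N.
Proof. by rewrite horner_rule_poly big_ord1 /= bin0 !expr0 !mul1r. Qed.

Lemma rule_poly_affine m phi psi (a b c z : R) :
  (rule_poly m (fun k => a + b * phi k + c * psi k)).[z] =
  a + b * (rule_poly m phi).[z] + c * (rule_poly m psi).[z].
Proof.
elim: m phi psi => [|m IH] phi psi; first by rewrite !rule_poly0.
by rewrite !rule_polyS !IH; ring.
Qed.

Lemma rule_poly_natr m z : (rule_poly m (fun k => k%:R)).[z] = m%:R * z.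
Proof.
elim: m => [|m IH]; first by rewrite rule_poly0 mul0r.
rewrite rule_polyS IH.
have -> : (rule_poly m (fun k => k.+1%:R)).[z] = 1 + m%:R * z.
  rewrite -IH -[RHS]addr0 -[X in _ + X + _]mul1r.
  rewrite -[X in _ = _ + X](mul0r (rule_poly m (fun k => k%:R)).[z]).
  rewrite -rule_poly_affine; congr (rule_poly m _).[z].
  by apply/funext => k; rewrite -natr1; ring.
by rewrite -natr1; ring.
Qed.

Lemma le_rule_poly m phi psi z : 0 <= z <= 1 ->
  (forall k, (k <= m)%N -> phi k <= psi k) ->
  (rule_poly m phi).[z] <= (rule_poly m psi).[z].
Proof.
move=> /andP[z0 z1] le_phi; rewrite !horner_rule_poly.
apply: ler_sum => k _; apply: ler_wpM2l.
  by rewrite !mulr_ge0 ?exprn_ge0 // subr_ge0.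
by apply: le_phi; rewrite -ltnS.
Qed.

Lemma rule_poly_cst m (c z : R) : (rule_poly m (fun=> c)).[z] = c.
Proof.
by elim: m => [|m IH]; rewrite ?rule_poly0 // rule_polyS IH; ring.
Qed.

Lemma rule_poly_itv m phi z : (forall k, (k <= m)%N -> 0 <= phi k <= 1) ->
  0 <= z <= 1 -> 0 <= (rule_poly m phi).[z] <= 1.
Proof.
move=> hphi hz; rewrite -{1}(rule_poly_cst m 0 z) -(rule_poly_cst m 1 z).
by apply/andP; split; apply: le_rule_poly => // k /hphi /andP[].
Qed.

(** A binomial average is at least the least of the averaged values; this
    extracts a good outcome from a bound in the mean. *)
Lemma rule_poly_pick m phi (c z : R) : 0 <= z <= 1 ->
  (rule_poly m phi).[z] <= c -> exists2 k, (k <= m)%N & phi k <= c.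
Proof.
move=> hz le_c; apply: contrapT => no_k.
have gt_c k : (k <= m)%N -> c < phi k.
  by move=> km; rewrite ltNge; apply/negP => le; apply: no_k; exists k.
(* The least value is a strict bound only because there are finitely many. *)
pose e := \big[Order.min/phi 0%N]_(k < m.+1) phi k.
have e_gt : c < e.
  rewrite /e; elim/big_ind: _ => [|x y cx cy|i _]; first exact: gt_c.
    by rewrite lt_min cx cy.
  by apply: gt_c; rewrite -ltnS.
have e_le : e <= (rule_poly m phi).[z].
  rewrite -(rule_poly_cst m e z); apply: le_rule_poly => // k km.
  by rewrite /e (bigD1 (Ordinal (km : (k < m.+1)%N))) //= ge_min lexx.
by have := lt_le_trans e_gt (le_trans e_le le_c); rewrite ltxx.
Qed.

Lemma sum_tupleS (V : finType) (M : nmodType) m (F : m.+1.-tuple V -> M) :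
  \sum_w F w = \sum_v \sum_(w : m.-tuple V) F [tuple of v :: w].
Proof.
rewrite pair_big /= (reindex (fun vw : V * m.-tuple V => [tuple of vw.1 :: vw.2])) //=.
exists (fun w => (thead w, [tuple of behead w])) => [[v w] _|w _] /=.
  by congr pair; apply: val_inj.
by rewrite [RHS]tuple_eta.
Qed.

(** With [m] independent choices of law [a], the number of red ones is binomial,
    so that averaging [phi] of that number amounts to evaluating the polynomial
    of the rule [phi]. *)
Lemma sum_tuple_count (V : finType) (a : V -> R) (red : pred V) m phi :
  \sum_v a v = 1 ->
  \sum_(w : m.-tuple V) (\prod_(v <- w) a v) * phi (count red w) =
  (rule_poly m phi).[\sum_(v | red v) a v].
Proof.
move=> a1; elim: m phi => [|m IH] phi.
  rewrite rule_poly0 (bigD1 [tuple]) //= big_nil mul1r big1 ?addr0 // => w /eqP[].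
  exact: tuple0.
rewrite sum_tupleS rule_polyS (bigID red) /=; congr (_ + _).
  rewrite mulr_suml; apply: eq_bigr => v rv; rewrite -IH mulr_sumr.
  by apply: eq_bigr => w _; rewrite big_cons /= rv mulrA.
have -> : 1 - \sum_(v | red v) a v = \sum_(v | ~~ red v) a v.
  by rewrite -a1 (bigID red) /= addrAC subrr add0r.
rewrite mulr_suml; apply: eq_bigr => v rv; rewrite -IH mulr_sumr.
by apply: eq_bigr => w _; rewrite big_cons /= (negbTE rv) mulrA.
Qed.
End Binomial.

(** * Degrees by community and colour *)

Local Notation other := (@rev_ord 2).

Lemma other_neq (i : 'I_2) : other i != i.
Proof. by case: i => [[|[|]]]. Qed.

Lemma neq_other (i j : 'I_2) : (i != j) = (i == other j).
Proof. by case: i j => [[|[|//]] ?] [[|[|//]] ?]. Qed.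

Lemma other_ind (Q : 'I_2 -> Prop) y : Q y -> Q (other y) -> forall i, Q i.
Proof.
by move=> Qy Qo i; have [->//|] := eqVneq i y; rewrite neq_other => /eqP ->.
Qed.

Lemma sum_other (V : nmodType) (F : 'I_2 -> V) y : \sum_i F i = F y + F (other y).
Proof.
rewrite (bigD1 y) //= (bigD1 (other y)) ?other_neq //= big1 ?addr0 // => i.
by rewrite neq_other => /andP[/eqP-> /eqP].
Qed.

Section Ends.
Open Scope nat_scope.
Implicit Types (g : tgraph 2) (Q : pred ('I_2 * bool)).

Definition label0 : 'I_2 * bool := (ord0, false).

Definition label_deg g Q : nat :=
  \sum_(v : vertex g | Q (tnth (in_tuple g.1) v)) deg v.

Definition valid g : Prop :=
  forall e, e \in g.2 -> e.1 < size g.1 /\ e.2 < size g.1.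

(** Counting edge-ends edge by edge rather than vertex by vertex keeps the sum
    independent of the vertex type, which changes with each new vertex. *)
Lemma label_deg_edges g Q : valid g ->
  label_deg g Q = \sum_(e <- g.2) (Q (nth label0 g.1 e.1) + Q (nth label0 g.1 e.2)).
Proof.
have pick k : k < size g.1 ->
    \sum_(v : vertex g | Q (tnth (in_tuple g.1) v)) (k == v) =
    Q (nth label0 g.1 k).
  move=> kg; rewrite big_mkcond (bigD1 (Ordinal kg)) //= big1 => [|v].
    by rewrite eqxx addn0 (tnth_nth label0) /=; case: (Q _).
  rewrite -val_eqE /= eq_sym => /negbTE ->; by case: ifP.
move=> vg; rewrite /label_deg /deg exchange_big /=.
rewrite big_seq [RHS]big_seq; apply: eq_bigr => e /vg [e1 e2].
by rewrite big_split /= !pick.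
Qed.

Lemma valid_add m g y (w : m.-tuple (vertex g)) b :
  valid g -> valid (add_vertex y w b).
Proof.
move=> vg e; rewrite /= size_rcons mem_cat => /orP[/vg[? ?]|/mapP[v _ ->]] /=.
  by split; apply: ltnW.
by split => //; rewrite ltnS ltnW.
Qed.

Lemma label_deg_add m g y (w : m.-tuple (vertex g)) b Q : valid g ->
  label_deg (add_vertex y w b) Q =
  label_deg g Q + m * Q (y, b) + count (fun v => Q (tnth (in_tuple g.1) v)) w.
Proof.
move=> vg; rewrite !label_deg_edges //; last exact: valid_add.
rewrite /= big_cat /= -addnA; congr (_ + _).
  rewrite big_seq [RHS]big_seq; apply: eq_bigr => e /vg [e1 e2].
  by rewrite !nth_rcons e1 e2.
rewrite big_map big_split /= nth_rcons ltnn eqxx; congr (_ + _).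
  by rewrite big_const_seq count_predT size_tuple iter_addn_0 mulnC.
rewrite -sum1_count [RHS]big_mkcond; apply: eq_bigr => v _.
by rewrite /= nth_rcons ltn_ord (tnth_nth label0) /=; case: (Q _).
Qed.

Definition colour_deg g (i : 'I_2) (c : bool) := label_deg g (pred1 (i, c)).

Definition community_deg g i := colour_deg g i true + colour_deg g i false.

Lemma community_degE g i : label_deg g (fun l => l.1 == i) = community_deg g i.
Proof.
rewrite /community_deg /colour_deg /label_deg (bigID (fun v => (tnth (in_tuple g.1) v).2)) /=.
by congr (_ + _); apply: eq_bigl => v; rewrite -pair_eqE /=; case: (tnth _ _).2;
  rewrite ?andbT ?andbF.
Qed.

End Ends.

(** * One step of the process *)

Section Step.
Variables (R : realType) (m : nat) (p : nat -> R) (mu : 'I_2 -> R).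
Implicit Types (g : tgraph 2) (y i : 'I_2).

Definition cross_attractiveness : 'M[R]_2 := \matrix_(x < 2, y < 2) (x != y)%:R.

Lemma red_proportionE g i :
  red_proportion R g i = (colour_deg g i true)%:R / (community_deg g i)%:R.
Proof.
rewrite -community_degE /red_proportion; congr (_%:R / _%:R).
by apply: eq_bigl => v; rewrite /community /is_red /= -pair_eqE /= eqb_id andbC.
Qed.

Lemma red_proportion_itv g i : 0 <= red_proportion R g i <= 1.
Proof.
rewrite red_proportionE divr_ge0 //=; have [->|t0] := posnP (community_deg g i).
  by rewrite invr0 mulr0.
by rewrite ler_pdivrMr ?ltr0n // mul1r ler_nat leq_addr.
Qed.

Lemma attach_probE g y (v : vertex g) : attach_prob cross_attractiveness y v =
  (community v == other y)%:R * (deg v)%:R / (community_deg g (other y))%:R.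
Proof.
rewrite /attach_prob mxE neq_other; congr (_ / _).
rewrite -community_degE /label_deg natr_sum [RHS]big_mkcond; apply: eq_bigr => u _.
by rewrite mxE neq_other /community; case: eqP; rewrite ?mul1r ?mul0r.
Qed.

Lemma sum_attach_prob g y (Q : pred (vertex g)) :
  \sum_(v | Q v) attach_prob cross_attractiveness y v =
  (\sum_(v | Q v && (community v == other y)) deg v)%N%:R
    / (community_deg g (other y))%:R.
Proof.
rewrite natr_sum mulr_suml big_mkcondr /=; apply: eq_bigr => v _.
by rewrite attach_probE; case: eqP; rewrite ?mul1r ?mul0r.
Qed.

Lemma step_prob_neq0 g y (w : m.-tuple (vertex g)) b :
  step_prob cross_attractiveness mu p y w b != 0 ->
  (if b then p (count (@is_red 2 g) w) else 1 - p (count (@is_red 2 g) w)) != 0 /\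
  forall v, v \in w -> community v = other y /\ (0 < deg v)%N.
Proof.
rewrite /step_prob !mulf_eq0 !negb_or -andbA => /and3P[_ + rule_neq0].
rewrite prodf_seq_neq0 => /allP attach_neq0; split=> // v /attach_neq0 /=.
rewrite attach_probE lt0n.
case: (community v =P _) => [cv|_]; last by rewrite !mul0r eqxx.
by move=> nz; split=> //; apply: contraNneq nz => ->; rewrite mulr0 mul0r.
Qed.

Lemma colour_deg_step g y (w : m.-tuple (vertex g)) b : valid g ->
  (forall v, v \in w -> community v = other y) ->
  [/\ forall c, colour_deg (add_vertex y w b) y c = (colour_deg g y c + m * (b == c))%N,
      colour_deg (add_vertex y w b) (other y) true =
        (colour_deg g (other y) true + count (@is_red 2 g) w)%N &
      colour_deg (add_vertex y w b) (other y) false =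
        (colour_deg g (other y) false + (m - count (@is_red 2 g) w))%N].
Proof.
move=> vg hw; rewrite /colour_deg; split=> [c||]; rewrite label_deg_add //=.
- rewrite -pair_eqE /= eqxx /= -[RHS]addn0; congr (_ + _)%N.
  transitivity (count pred0 w); last exact: count_pred0.
  apply: eq_in_count => v /hw.
  by rewrite /community => /= ->; rewrite (negbTE (other_neq y)).
- rewrite -pair_eqE /= eq_sym (negbTE (other_neq y)) muln0 addn0; congr (_ + _)%N.
  apply: eq_in_count => v /hw.
  by rewrite /community /is_red => /= ->; rewrite eqxx eqb_id.
- rewrite -pair_eqE /= eq_sym (negbTE (other_neq y)) muln0 addn0; congr (_ + _)%N.
  rewrite -[X in (X - _)%N](size_tuple w) -(count_predC (@is_red 2 g)) addKn.
  apply: eq_in_count => v /hw.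
  by rewrite /community /is_red => /= ->; rewrite eqxx eqbF_neg.
Qed.

Definition mean_step (F : tgraph 2 -> R) g : R :=
  \sum_y \sum_(w : m.-tuple (vertex g)) \sum_b
    step_prob cross_attractiveness mu p y w b * F (add_vertex y w b).

(** Every neighbour of a newcomer to [y] is red with probability equal to the
    red proportion of the other community, hence a binomial number of red
    neighbours. *)
Lemma sum_step_prob g (phi : 'I_2 -> nat -> bool -> R) :
  (forall i, 0 < community_deg g i)%N ->
  \sum_y \sum_(w : m.-tuple (vertex g)) \sum_b
    step_prob cross_attractiveness mu p y w b * phi y (count (@is_red 2 g) w) b =
  \sum_y mu y * (rule_poly m (fun k =>
     p k * phi y k true + (1 - p k) * phi y k false)
   ).[red_proportion R g (other y)].
Proof.
move=> t0; apply: eq_bigr => y _.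
have -> : red_proportion R g (other y) =
    \sum_(v : vertex g | is_red v) attach_prob cross_attractiveness y v.
  by rewrite sum_attach_prob -community_degE.
rewrite -sum_tuple_count; last first.
  rewrite sum_attach_prob /=.
  have -> : (\sum_(v : vertex g | community v == other y) deg v)%N =
    community_deg g (other y) by rewrite -community_degE.
  by rewrite divff // pnatr_eq0 -lt0n.
rewrite mulr_sumr; apply: eq_bigr => w _.
by rewrite big_bool /step_prob /=; ring.
Qed.

Hypothesis hp : forall k, (k <= m)%N -> 0 <= p k <= 1.
Hypothesis hmu_pos : forall i, 0 < mu i.
Hypothesis hmu_sum : \sum_i mu i = 1.

Lemma attach_prob_ge0 g y (v : vertex g) : 0 <= attach_prob cross_attractiveness y v.
Proof. by rewrite attach_probE divr_ge0 ?mulr_ge0. Qed.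

Lemma count_le_size g (w : m.-tuple (vertex g)) : (count (@is_red 2 g) w <= m)%N.
Proof. by rewrite -[X in (_ <= X)%N](size_tuple w) count_size. Qed.

Lemma step_prob_ge0 g y (w : m.-tuple (vertex g)) b :
  0 <= step_prob cross_attractiveness mu p y w b.
Proof.
rewrite /step_prob; apply: mulr_ge0.
  apply: mulr_ge0; first exact: ltW.
  by apply: prodr_ge0 => v _; exact: attach_prob_ge0.
have /andP[p0 p1] := hp (count_le_size w).
by case: b => //; rewrite subr_ge0.
Qed.

Lemma mean_step_le g F (phi : 'I_2 -> nat -> bool -> R) :
  (forall i, 0 < community_deg g i)%N ->
  (forall y (w : m.-tuple (vertex g)) b, step_prob cross_attractiveness mu p y w b != 0 ->
     F (add_vertex y w b) <= phi y (count (@is_red 2 g) w) b) ->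
  mean_step F g <= \sum_y mu y * (rule_poly m (fun k =>
     p k * phi y k true + (1 - p k) * phi y k false)
   ).[red_proportion R g (other y)].
Proof.
move=> t0 Fle; rewrite -sum_step_prob //.
apply: ler_sum => y _; apply: ler_sum => w _; apply: ler_sum => b _.
have [->|s0] := eqVneq (step_prob cross_attractiveness mu p y w b) 0; first by rewrite !mul0r.
by rewrite ler_wpM2l ?step_prob_ge0 // Fle.
Qed.

Lemma mean_step_cst g (c : R) : (forall i, 0 < community_deg g i)%N ->
  mean_step (fun=> c) g = c.
Proof.
move=> t0; rewrite /mean_step (sum_step_prob (fun _ _ _ => c)) //.
under eq_bigr => y _.
  have -> : (fun k => p k * c + (1 - p k) * c) = (fun=> c).
    by apply/funext => k; ring.
  rewrite rule_poly_cst; over.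
by rewrite -mulr_suml hmu_sum mul1r.
Qed.

Lemma mean_stepD g (F1 F2 : tgraph 2 -> R) a b :
  mean_step (fun h => a * F1 h + b * F2 h) g =
  a * mean_step F1 g + b * mean_step F2 g.
Proof.
rewrite /mean_step !mulr_sumr -big_split; apply: eq_bigr => y _ /=.
rewrite !mulr_sumr -big_split; apply: eq_bigr => w _ /=.
rewrite !mulr_sumr -big_split; apply: eq_bigr => c _ /=.
by ring.
Qed.

(** Repeating one red and one blue vertex, as choices are made with replacement,
    realises any number of red neighbours that the colours present allow. *)
Lemma step_choice g y (k : nat) c : (k <= m)%N ->
  ((0 < k)%N -> (0 < colour_deg g (other y) true)%N) ->
  ((k < m)%N -> (0 < colour_deg g (other y) false)%N) ->
  0 < (if c then p k else 1 - p k) ->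
  exists w : m.-tuple (vertex g),
    count (@is_red 2 g) w = k /\ 0 < step_prob cross_attractiveness mu p y w c.
Proof.
move=> km hr hb hc.
have ex b : (0 < colour_deg g (other y) b)%N -> exists v : vertex g,
    [/\ is_red v = b, community v = other y & (0 < deg v)%N].
  rewrite /colour_deg /label_deg lt0n sum_nat_eq0 => /forallPn[v].
  rewrite negb_imply -lt0n => /andP[/eqP lv dv].
  by exists v; rewrite /is_red /community lv.
have [s [ss cs as_]] : exists s : seq (vertex g), [/\ size s = m,
    count (@is_red 2 g) s = k &
    all (fun v => (community v == other y) && (0 < deg v)%N) s].
  have [s1 [ss1 cs1 as1]] : exists s : seq (vertex g), [/\ size s = k,
    count (@is_red 2 g) s = k &
    all (fun v => (community v == other y) && (0 < deg v)%N) s].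
    case: k {km hb hc} hr => [|k] hr; first by exists [::].
    have [//|v [rv cv dv]] := ex true; first exact: hr.
    exists (nseq k.+1 v); rewrite size_nseq count_nseq rv mul1n; split => //.
    by rewrite all_nseq cv eqxx dv.
  have [s2 [ss2 cs2 as2]] : exists s : seq (vertex g), [/\ size s = (m - k)%N,
    count (@is_red 2 g) s = 0%N &
    all (fun v => (community v == other y) && (0 < deg v)%N) s].
    have [mk|mk] := leqP m k.
      by exists [::]; split=> //=; apply/esym/eqP; rewrite subn_eq0.
    have [//|v [rv cv dv]] := ex false; first exact: hb.
    exists (nseq (m - k) v); rewrite size_nseq count_nseq rv mul0n; split => //.
    by rewrite all_nseq cv eqxx dv orbT.
  exists (s1 ++ s2); rewrite size_cat count_cat all_cat ss1 ss2 cs1 cs2 as1 as2.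
  by rewrite subnKC // addn0.
exists (tcast ss (in_tuple s)).
have sE : tcast ss (in_tuple s) = s :> seq _ by rewrite val_tcast.
rewrite /step_prob sE cs; split => //; rewrite !mulr_gt0 //.
rewrite big_seq; apply: prodr_gt0 => v /(allP as_)/andP[/eqP cv dv].
have tot : (0 < community_deg g (other y))%N.
  rewrite -community_degE /label_deg (bigD1 v) /=; last by rewrite -cv.
  by rewrite addn_gt0 dv.
by rewrite attach_probE cv eqxx mul1r divr_gt0 ?ltr0n.
Qed.
End Step.

(** * Measurability of limit events *)

Section Measurability.
Context d (T : measurableType d).

Lemma measurable_exists (S : countType) (F : S -> set T) :
  (forall s, measurable (F s)) -> measurable [set x | exists s, F s x].
Proof.
move=> mF.
have -> : [set x | exists s, F s x] = \bigcup_s F s.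
  by apply/seteqP; split=> x [s]; [exists s|move=> _; exists s].
by apply: countable_bigcupT_measurable => //; exact: countableP.
Qed.

Lemma measurable_forall (S : countType) (F : S -> set T) :
  (forall s, measurable (F s)) -> measurable [set x | forall s, F s x].
Proof.
move=> mF.
have -> : [set x | forall s, F s x] = ~` [set x | exists s, (~` F s) x].
  apply/seteqP; split=> x /=; first by move=> h [s] /(_ (h s)).
  by move=> h s; apply: contrapT => nF; apply: h; exists s.
by apply/measurableC/measurable_exists => s; exact: measurableC.
Qed.

Lemma measurable_imply (Q : Prop) (A : set T) :
  measurable A -> measurable [set x | Q -> A x].
Proof.
move=> mA; have [q|nq] := pselect Q.
  by rewrite (_ : mkset _ = A) //; apply/seteqP; split=> x /=; [apply|].
by rewrite (_ : mkset _ = setT) //; apply/seteqP; split=> // x _ /nq.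
Qed.

Lemma measurable_rel2 (S : countType) (f g : T -> S) (Q : S -> S -> Prop) :
  (forall s, measurable [set x | f x = s]) ->
  (forall s, measurable [set x | g x = s]) ->
  measurable [set x | Q (f x) (g x)].
Proof.
move=> mf mg.
have -> : [set x | Q (f x) (g x)] = [set x | exists s : S * S,
    ([set x | f x = s.1] `&` [set x | g x = s.2] `&` [set x | Q s.1 s.2]) x].
  apply/seteqP; split=> x /=; first by exists (f x, g x).
  by move=> [[s1 s2] /= [[-> ->]]].
apply: measurable_exists => s; apply: measurableI; first exact: measurableI.
have [q|nq] := pselect (Q s.1 s.2).
  by rewrite (_ : mkset _ = setT) //; apply/seteqP; split.
by rewrite (_ : mkset _ = set0) //; apply/seteqP; split.
Qed.

End Measurability.

Section LimitEvents.
Variable R : realType.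

Lemma cvg_seqP (u : nat -> R) : cvg (u @ \oo) <->
  forall k, exists n, forall i, (n <= i)%N -> `|u n - u i| < k.+1%:R^-1.
Proof.
split=> [/cauchy_cvgP/cauchyP cu k|cu].
  have [z [n _ zn]] := cu (k.+1%:R^-1 / 2) ltac:(by rewrite divr_gt0 ?invr_gt0).
  exists n => i ni.
  have := zn n (leqnn n); have := zn i ni; rewrite /ball /= => h1 h2.
  rewrite [X in _ < X]splitr; apply: le_lt_trans (ltrD h2 h1).
  by rewrite (distrC z (u n)) ler_distD.
apply/cauchy_cvgP/cauchy_exP => e e0.
have [k ke] : exists k, k.+1%:R^-1 < e.
  have [k] := near_infty_natSinv_lt (PosNum e0).
  by move=> _ /(_ k (leqnn k)) /= ?; exists k.
have [n un] := cu k; exists (u n); exists n => //= i ni.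
by rewrite /ball /=; apply: lt_trans (un i ni) ke.
Qed.

(** Convergence by Cauchy's criterion, and distinctness of the limits by eventual
    separation, involve countably many conditions on finitely many times. *)
Lemma distinct_limitsP (u v : nat -> R) :
  (exists z1 z2 : R, [/\ z1 <> z2, u @ \oo --> z1 & v @ \oo --> z2]) <->
  [/\ cvg (u @ \oo), cvg (v @ \oo) &
    exists k n, forall i, (n <= i)%N -> k.+1%:R^-1 <= `|u i - v i|].
Proof.
split=> [[z1 [z2 [z12 uz vz]]]|[cu cv [k [n uv]]]].
  split; [by apply/cvg_ex; exists z1|by apply/cvg_ex; exists z2|].
  have e0 : 0 < `|z1 - z2| by rewrite normr_gt0 subr_eq0; apply/eqP.
  have [k] := near_infty_natSinv_lt (PosNum e0).
  move=> _ /(_ k (leqnn k)) /= ke; exists k.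
  have /cvgr_gt/(_ _ ke) [n _ h] : (fun i => `|u i - v i|) @ \oo --> `|z1 - z2|.
    by apply: cvg_norm; apply: cvgB.
  by exists n => i /h /ltW.
exists (lim (u @ \oo)), (lim (v @ \oo)); split => // e.
have : (fun i => `|u i - v i|) @ \oo --> `|lim (u @ \oo) - lim (v @ \oo)|.
  by apply: cvg_norm; apply: cvgB.
rewrite e subrr normr0 => /cvgr_lt/(_ k.+1%:R^-1).
case; first by rewrite invr_gt0.
move=> n' _ h; have := h (maxn n n') (leq_maxr _ _) => /=.
by rewrite ltNge uv // leq_maxl.
Qed.

Lemma measurable_distinct_limits d (T : measurableType d) (S : countType)
    (G : nat -> T -> S) (u v : S -> R) :
  (forall t s, measurable [set x | G t x = s]) ->
  measurable [set x | exists z1 z2 : R, [/\ z1 <> z2,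
    (fun t => u (G t x)) @ \oo --> z1 & (fun t => v (G t x)) @ \oo --> z2]].
Proof.
move=> mG.
have mcvg (w : S -> R) : measurable [set x | cvg ((fun t => w (G t x)) @ \oo)].
  have -> : [set x | cvg ((fun t => w (G t x)) @ \oo)] =
     [set x | forall k, [set x | exists n, [set x | forall i, [set x |
       (n <= i)%N -> [set x | `|w (G n x) - w (G i x)| < k.+1%:R^-1] x] x] x] x].
    by apply/seteqP; split=> x /= /cvg_seqP.
  apply: measurable_forall => k; apply: measurable_exists => n.
  apply: measurable_forall => i; apply: measurable_imply.
  exact: (measurable_rel2 (fun s s' => `|w s - w s'| < k.+1%:R^-1)).
have -> : [set x | exists z1 z2 : R, [/\ z1 <> z2,
    (fun t => u (G t x)) @ \oo --> z1 & (fun t => v (G t x)) @ \oo --> z2]] =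
  [set x | cvg ((fun t => u (G t x)) @ \oo)] `&`
  [set x | cvg ((fun t => v (G t x)) @ \oo)] `&`
  [set x | exists k, [set x | exists n, [set x | forall i, [set x |
     (n <= i)%N -> [set x | k.+1%:R^-1 <= `|u (G i x) - v (G i x)|] x] x] x] x].
  apply/seteqP; split=> x /=; first by move/distinct_limitsP => [].
  by move=> [[? ?] ?]; apply/distinct_limitsP.
apply: measurableI; first exact: measurableI.
apply: measurable_exists => k; apply: measurable_exists => n.
apply: measurable_forall => i; apply: measurable_imply.
exact: (measurable_rel2 (fun s s' => k.+1%:R^-1 <= `|u s - v s'|)).
Qed.

End LimitEvents.

(** * A maximal inequality for the process *)

Lemma add_vertex_inj m (g : tgraph 2) y y' (w w' : m.-tuple (vertex g)) b b' :
  add_vertex y w b = add_vertex y' w' b' -> (y, w, b) = (y', w', b').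
Proof.
case=> /rcons_inj[-> ->] /eqP; rewrite eqseq_cat // eqxx /= => /eqP e.
congr (_, _, _); apply/val_inj.
apply: (@inj_map _ _ (fun v : vertex g => (size g.1, nat_of_ord v))) => //.
by move=> v v' [] /val_inj.
Qed.

Lemma sum_probability_le d (T : measurableType d) (R : realType)
    (P : probability T R) (I : finType) (A : I -> set T) (B : set T) :
  (forall i, measurable (A i)) -> measurable B ->
  (forall i, A i `<=` B) -> (forall i j x, A i x -> A j x -> i = j) ->
  (\sum_i P (A i) <= P B)%E.
Proof.
move=> mA mB AB dA.
have tA : trivIset [set` enum I] A by move=> i j _ _ [x [/dA h /h]].
rewrite -big_enum /= fsbig_seq ?enum_uniq //.
rewrite -measure_fin_bigcup //.
apply: le_measure; rewrite ?inE //; last by move=> x [i _ /AB].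
by apply: fin_bigcup_measurable.
Qed.

Section Process.
Context (R : realType) (m : nat) (p : nat -> R) (mu : 'I_2 -> R).
Hypothesis hmu_sum : \sum_i mu i = 1.
Context d (T : measurableType d) (P : probability T R) (g0 : tgraph 2).
Context (G : nat -> T -> tgraph 2).
Hypothesis hG : attachment_process P (cross_attractiveness R) mu m p g0 G.

Lemma measurable_path_event (D : pred nat) (Q : nat -> tgraph 2 -> Prop) :
  measurable [set x | forall s, D s -> Q s (G s x)].
Proof.
apply: (@measurable_forall _ _ nat
  (fun s => [set x | D s -> [set x | Q s (G s x)] x])) => s.
apply: measurable_imply.
by apply: (measurable_rel2 (fun g _ => Q s g)); exact: (process_measurable hG).
Qed.

(** Keeping the whole history, with its last graph [g], is what allows the law of
    the next step to be used: it is given conditionally on histories. *)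
Definition history_event t (g : tgraph 2) (H : set T) := exists2 h : nat -> tgraph 2,
  h t = g & H = [set x | forall s, (s <= t)%N -> G s x = h s].

Lemma history0 : history_event 0 g0 setT.
Proof.
exists (fun=> g0) => //; apply/seteqP; split=> x // _ s.
by rewrite leqn0 => /eqP ->; exact: (process_initial hG).
Qed.

Lemma history_sub t g H : history_event t g H -> H `<=` [set x | G t x = g].
Proof. by move=> [h <- ->] x; apply. Qed.

Lemma measurable_history t g H : history_event t g H -> measurable H.
Proof.
move=> [h _ ->].
exact: (measurable_path_event (fun s => (s <= t)%N) (fun s g => g = h s)).
Qed.

Lemma history_step t g H y (w : m.-tuple (vertex g)) b : history_event t g H ->
  P (H `&` [set x | G t.+1 x = add_vertex y w b]) =
    (P H * (step_prob (cross_attractiveness R) mu p y w b)%:E)%E /\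
  history_event t.+1 (add_vertex y w b)
    (H `&` [set x | G t.+1 x = add_vertex y w b]).
Proof.
move=> [h hg ->]; subst g; split; first exact: (process_step hG).
exists (fun s => if (s <= t)%N then h s else add_vertex y w b).
  by rewrite ltnn.
apply/seteqP; split=> x /=.
  by move=> [hx hx'] s; rewrite leq_eqVlt ltnS => /orP[/eqP->|st]; rewrite ?ltnn // st hx.
move=> hx; split=> [s st|]; first by rewrite hx ?st // leqW.
by rewrite hx // ltnn.
Qed.

Variables (Inv good : nat -> tgraph 2 -> Prop) (f : nat -> tgraph 2 -> R).
Hypothesis Inv_step : forall t g y (w : m.-tuple (vertex g)) b, Inv t g ->
  step_prob (cross_attractiveness R) mu p y w b != 0 -> Inv t.+1 (add_vertex y w b).
Hypothesis Inv_deg_gt0 : forall t g, Inv t g -> forall i, (0 < community_deg g i)%N.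
Hypothesis f_ge0 : forall t g, 0 <= f t g.
Hypothesis f_bad : forall t g, Inv t g -> ~ good t g -> 1 <= f t g.
Hypothesis f_super : forall t g, Inv t g -> good t g ->
  mean_step m p mu (f t.+1) g <= f t g.

(** [Inv] collects what every possible step preserves, [good] what may fail. *)
Definition stays_good t n := [set x | forall s, (t <= s <= t + n)%N ->
  Inv s (G s x) /\ good s (G s x)].

Lemma measurable_stays_good t n : measurable (stays_good t n).
Proof.
exact: (measurable_path_event (fun s => (t <= s <= t + n)%N)
  (fun s g => Inv s g /\ good s g)).
Qed.

(** Ville's maximal inequality: a nonnegative supermartingale that is at least 1
    off [good] leaves [good] with probability at most its initial value.  The
    induction is on the horizon, conditioning on the first step, so that neither
    stopping times nor conditional expectations are involved. *)
Lemma stays_good_bound n t g H : history_event t g H -> Inv t g ->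
  ((1 - f t g)%:E * P H <= P (H `&` stays_good t n))%E.
Proof.
elim: n t g H => [|n IH] t g H hH Ig.
  have [gg|ng] := pselect (good t g); last first.
    apply: (@le_trans _ _ 0%E); last exact: measure_ge0.
    by apply: mule_le0_ge0 => //; rewrite lee_fin subr_le0 f_bad.
  have -> : H `&` stays_good t 0 = H.
    apply/seteqP; split=> x; first by case.
    move=> hx; split=> // s; rewrite addn0 -eqn_leq => /eqP <-.
    by rewrite (history_sub hH hx).
  rewrite -[leRHS]mul1e; apply: lee_wpmul2r => //.
  by rewrite lee_fin gerBl f_ge0.
have [gg|ng] := pselect (good t g); last first.
  apply: (@le_trans _ _ 0%E); last exact: measure_ge0.
  by apply: mule_le0_ge0 => //; rewrite lee_fin subr_le0 f_bad.
pose next (i : 'I_2 * m.-tuple (vertex g) * bool) :=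
  add_vertex i.1.1 i.1.2 i.2.
pose A i := (H `&` [set x | G t.+1 x = next i]) `&` stays_good t.+1 n.
pose sp (i : 'I_2 * m.-tuple (vertex g) * bool) :=
  step_prob (cross_attractiveness R) mu p i.1.1 i.1.2 i.2.
have hA i : history_event t.+1 (next i) (H `&` [set x | G t.+1 x = next i]).
  by case: (history_step i.1.1 i.1.2 i.2 hH).
have mH := measurable_history hH.
apply: (@le_trans _ _ (\sum_i P (A i))%E); last first.
  apply: sum_probability_le => [i||i x|i j x].
  - apply: measurableI; last exact: measurable_stays_good.
    exact: measurable_history (hA i).
  - by apply: measurableI => //; exact: measurable_stays_good.
  - move=> [[Hx Gx] sx]; split => // s /andP[].
    rewrite leq_eqVlt => /orP[/eqP <- _|ts sn].
      by rewrite (history_sub hH Hx).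
    by apply: sx; rewrite ts addSnnS.
  - move=> [[_ gi] _] [[_ gj] _]; have := add_vertex_inj (etrans (esym gi) gj).
    by move: i j {gi gj} => [[? ?] ?] [[? ?] ?].
have PH : P H = (fine (P H))%:E by rewrite fineK // fin_num_measure.
set r := fine (P H) in PH.
have r0 : 0 <= r by rewrite /r fine_ge0.
apply: (@le_trans _ _ (\sum_i ((1 - f t.+1 (next i)) * (r * sp i))%:E)%E); last first.
  apply: lee_sum => i _.
  have PA : P (H `&` [set x | G t.+1 x = next i]) = (r * sp i)%:E.
    by rewrite (history_step i.1.1 i.1.2 i.2 hH).1 PH.
  have [s0|s0] := eqVneq (sp i) 0.
    by rewrite s0 !mulr0 measure_ge0.
  rewrite EFinM -PA; apply: IH => //.
  exact: Inv_step.
rewrite sumEFin PH -EFinM lee_fin.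
have e : \sum_i (1 - f t.+1 (next i)) * (r * sp i) =
   r * mean_step m p mu (fun h => 1 * 1 + (-1) * f t.+1 h) g.
  rewrite /mean_step !pair_bigA /= mulr_sumr; apply: eq_bigr => i _.
  by rewrite /next /sp; ring.
rewrite e mean_stepD mean_step_cst //; last exact: Inv_deg_gt0 Ig.
rewrite mulrC ler_wpM2l // mul1r mulN1r lerB // .
exact: f_super.
Qed.

Lemma stays_good_forever t g H : history_event t g H -> Inv t g -> f t g < 1 ->
  (0 < P H)%E ->
  (0 < P [set x | forall s, (t <= s)%N -> Inv s (G s x) /\ good s (G s x)])%E.
Proof.
move=> hH Ig f1 PH0; set K := [set x | _].
have mS n : measurable (H `&` stays_good t n).
  by apply: measurableI; [exact: measurable_history hH|exact: measurable_stays_good].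
have mK : measurable K.
  exact: (measurable_path_event (leq t) (fun s g => Inv s g /\ good s g)).
have lim : P (H `&` stays_good t n) @[n --> \oo] -->
    P (\bigcap_n (H `&` stays_good t n)).
  apply: nonincreasing_cvg_mu => //.
  - exact: (le_lt_trans (probability_le1 _ (mS 0%N)) (ltry _)).
  - exact: bigcap_measurableType.
  - move=> n n' nn'; apply/subsetPset => x [Hx sx]; split=> // s /andP[ts sn].
    by apply: sx; rewrite ts (leq_trans sn) // leq_add2l.
apply: (@lt_le_trans _ _ (P (\bigcap_n (H `&` stays_good t n)))); last first.
  apply: le_measure; rewrite ?inE //; first exact: bigcap_measurableType.
  move=> x hx s ts; have [_] := hx (s - t)%N I.
  by apply; rewrite ts subnKC /=.
apply: (@lt_le_trans _ _ ((1 - f t g)%:E * P H)%E).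
  by rewrite mule_gt0 // lte_fin subr_gt0.
rewrite -(cvg_lim _ lim) //; apply: lime_ge; first by apply/cvg_ex; eexists; exact: lim.
by apply: nearW => n; exact: stays_good_bound.
Qed.

End Process.

(** * Analysis of the mean flow *)

Section Analysis.
Variable R : realType.

Lemma horner_second_order (f : {poly R}) (a : R) : exists2 M : R, 0 <= M &
  forall h, `|h| <= 1 -> `|f.[a + h] - f.[a] - f^`().[a] * h| <= M * h ^+ 2.
Proof.
(* Two more terms than the size, so that the constant and linear ones can be
   split off for every [f]. *)
exists (\sum_(i < (size f).+2) `|(f^`N(i)).[a]|); first exact: sumr_ge0.
move=> h h1.
rewrite (@nderiv_taylor_wide _ (size f).+2); [|exact: mulrC|exact/leqW/leqW].
rewrite !big_ord_recl /= nderivn0 nderivn1 expr0 mulr1 expr1.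
rewrite (_ : f.[a] + (f^`().[a] * h + _) - f.[a] - f^`().[a] * h =
  \sum_(i < size f) (f^`N(bump 0 (bump 0 i))).[a] * h ^+ bump 0 (bump 0 i)); last first.
  by rewrite /=; ring.
apply: (le_trans (ler_norm_sum _ _ _)).
rewrite !mulrDl -[leLHS]add0r; apply: lerD.
  by rewrite mulr_ge0 ?sqr_ge0.
rewrite -[leLHS]add0r; apply: lerD; first by rewrite mulr_ge0 ?sqr_ge0.
rewrite mulr_suml; apply: ler_sum => i _.
rewrite normrM ler_wpM2l // /bump /= !add1n normrX -[h ^+ 2]real_normK ?num_real //.
by rewrite -[in leLHS]add2n exprD ler_piMr ?sqr_ge0 // exprn_ile1.
Qed.

(** For the flow [u' = b0 v - u], [v' = b1 u - v], the derivative of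
    [x0 u^2 + x1 v^2] is minus twice the form
    [x0 u^2 - (x0 b0 + x1 b1) u v + x1 v^2], and the conclusion is that this form
    is positive definite.  Taking [x0 : x1 = |b1| : |b0|] balances the cross
    terms when neither slope vanishes; they cancel if [b0 b1 < 0]. *)
Lemma lyapunov_weights (b0 b1 : R) : b0 * b1 < 1 ->
  exists x0 x1 : R, [/\ 0 < x0, 0 < x1 & (x0 * b0 + x1 * b1) ^+ 2 < 4 * x0 * x1].
Proof.
move=> b01; have [->|b0n] := eqVneq b0 0.
  exists (b1 ^+ 2 + 1), 1; split=> //; first by rewrite ltr_wpDl ?sqr_ge0.
  by have := sqr_ge0 b1; nra.
have [->|b1n] := eqVneq b1 0.
  exists 1, (b0 ^+ 2 + 1); split=> //; first by rewrite ltr_wpDl ?sqr_ge0.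
  by have := sqr_ge0 b0; nra.
exists `|b1|, `|b0|; rewrite !normr_gt0; split=> //.
have [h|h] := ltrP 0 (b0 * b1).
  have -> : (`|b1| * b0 + `|b0| * b1) ^+ 2 = 4 * (b0 * b1) ^+ 2.
    move: h; case: (ltgtP b0 0) b0n => // h0 _; case: (ltgtP b1 0) b1n => // h1 _ h.
    - by rewrite !ltr0_norm //; ring.
    - by nra.
    - by nra.
    - by rewrite !gtr0_norm //; ring.
  rewrite -mulrA -normrM [b1 * b0]mulrC (gtr0_norm h) ltr_pM2l ?ltr0n //.
  by rewrite expr2 gtr_pMr.
have -> : `|b1| * b0 + `|b0| * b1 = 0.
  move: h; case: (ltgtP b0 0) b0n => // h0 _; case: (ltgtP b1 0) b1n => // h1 _ h.
  - by nra.
  - by rewrite gtr0_norm // ltr0_norm //; ring.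
  - by rewrite ltr0_norm // gtr0_norm //; ring.
  - by nra.
by rewrite expr0n /= !mulr_gt0 ?normr_gt0.
Qed.

Lemma quadratic_form_ge (x0 x1 B : R) : 0 < x0 -> 0 < x1 -> B ^+ 2 < 4 * x0 * x1 ->
  exists2 c : R, 0 < c & forall u v : R,
    c * (u ^+ 2 + v ^+ 2) <= x0 * u ^+ 2 - B * u * v + x1 * v ^+ 2.
Proof.
move=> x00 x10 hB; pose D := 4 * x0 * x1 - B ^+ 2; pose c := D / (4 * (x0 + x1)).
have D0 : 0 < D by rewrite subr_gt0.
have c0 : 0 < c by rewrite divr_gt0 // mulr_gt0 ?addr_gt0.
exists c => // u v.
have cE : 4 * c * (x0 + x1) = D by rewrite /c; field; lra.
have A0 : 0 < x0 - c.
  have : 4 * c * (x0 + x1) <= 4 * x0 * x1 by rewrite cE /D lerBlDr lerDl sqr_ge0.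
  by nra.
(* [c] is so small that subtracting it from both diagonal entries lowers the
   product [4 x0 x1] by at most the discriminant gap [D]. *)
have disc : B ^+ 2 <= 4 * (x0 - c) * (x1 - c).
  have -> : 4 * (x0 - c) * (x1 - c) = 4 * x0 * x1 - 4 * c * (x0 + x1) + 4 * c ^+ 2.
    by ring.
  by rewrite cE /D; have := sqr_ge0 c; lra.
rewrite -subr_ge0 -(pmulr_rge0 _ (_ : 0 < 4 * (x0 - c))); last by rewrite mulr_gt0.
have -> : 4 * (x0 - c) * (x0 * u ^+ 2 - B * u * v + x1 * v ^+ 2 - c * (u ^+ 2 + v ^+ 2))
  = (2 * (x0 - c) * u - B * v) ^+ 2 + (4 * (x0 - c) * (x1 - c) - B ^+ 2) * v ^+ 2.
  by ring.
by rewrite addr_ge0 ?sqr_ge0 // mulr_ge0 ?sqr_ge0 // subr_ge0.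
Qed.

(** Near the two-cycle the second-order error of [f] is dominated by half of the
    decrease of the linear part. *)
Lemma local_drift (f : {poly R}) (a0 a1 : R) :
  f.[a1] = a0 -> f.[a0] = a1 -> f^`().[a1] * f^`().[a0] < 1 ->
  exists x0 x1 c r : R, [/\ 0 < x0, 0 < x1, 0 < c & 0 < r] /\ forall u v,
    `|u| <= r -> `|v| <= r ->
    2 * x0 * u * (f.[a1 + v] - (a0 + u)) + 2 * x1 * v * (f.[a0 + u] - (a1 + v))
    <= - c * (u ^+ 2 + v ^+ 2).
Proof.
move=> fa1 fa0 /lyapunov_weights[x0 [x1 [x00 x10 hB]]].
have [c c0 hc] := quadratic_form_ge x00 x10 hB.
have [M0 M00 hM0] := horner_second_order f a0.
have [M1 M10 hM1] := horner_second_order f a1.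
pose K := x0 * M1 + x1 * M0 + 1.
have K0 : 0 < K.
  by rewrite ltr_wpDl // addr_ge0 // mulr_ge0 // ltW.
(* Radius 1 validates the second-order bounds; the other radius makes the error
   terms at most [c * (u ^+ 2 + v ^+ 2)]. *)
exists x0, x1, c, (Num.min 1 (c / (2 * K))); split.
  by split => //; rewrite lt_min ltr01 divr_gt0 ?mulr_gt0.
move=> u v; rewrite !le_min => /andP[u1 uc] /andP[v1 vc].
have /ler_normlP[_ +] := hM1 v v1; have /ler_normlP[+ _] := hM1 v v1.
have /ler_normlP[_ +] := hM0 u u1; have /ler_normlP[+ _] := hM0 u u1.
set e0 := f.[a0 + u] - _ - _; set e1 := f.[a1 + v] - _ - _ => e0l e0u e1l e1u.
have -> : f.[a1 + v] = a0 + f^`().[a1] * v + e1 by rewrite /e1 fa1; ring.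
have -> : f.[a0 + u] = a1 + f^`().[a0] * u + e0 by rewrite /e0 fa0; ring.
have -> : 2 * x0 * u * (a0 + f^`().[a1] * v + e1 - (a0 + u)) +
  2 * x1 * v * (a1 + f^`().[a0] * u + e0 - (a1 + v)) =
  - 2 * (x0 * u ^+ 2 - (x0 * f^`().[a1] + x1 * f^`().[a0]) * u * v + x1 * v ^+ 2)
  + (2 * x0 * (u * e1) + 2 * x1 * (v * e0)) by ring.
have H := hc u v.
have small w e M z : 0 <= M -> - e <= M * z ^+ 2 -> e <= M * z ^+ 2 ->
    `|w| <= c / (2 * K) -> w * e <= c / (2 * K) * M * z ^+ 2.
  move=> M_ge0 el eu wc; apply: (le_trans (ler_norm _)).
  rewrite normrM -mulrA; apply: ler_pM => //.
  by rewrite ler_norml eu andbT lerNl.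
have s1 := small u e1 M1 v M10 e1l e1u uc.
have s0 := small v e0 M0 u M00 e0l e0u vc.
set q := c / (2 * K) in s1 s0.
have qE : 2 * q * K = c by rewrite /q; field; lra.
have q0 : 0 < q by rewrite divr_gt0 ?mulr_gt0.
have t1 : 2 * x0 * (u * e1) <= 2 * x0 * (q * M1 * v ^+ 2) by rewrite ler_wpM2l //; lra.
have t0 : 2 * x1 * (v * e0) <= 2 * x1 * (q * M0 * u ^+ 2) by rewrite ler_wpM2l //; lra.
have xM1 : 0 <= x0 * M1 by rewrite mulr_ge0 // ltW.
have xM0 : 0 <= x1 * M0 by rewrite mulr_ge0 // ltW.
have q2 : 0 <= 2 * q by lra.
have u2 := sqr_ge0 u; have v2 := sqr_ge0 v.
have b1 : 2 * x0 * (q * M1 * v ^+ 2) <= 2 * q * (x0 * M1) * (u ^+ 2 + v ^+ 2).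
  have -> : 2 * x0 * (q * M1 * v ^+ 2) = 2 * q * (x0 * M1) * v ^+ 2 by ring.
  by rewrite ler_wpM2l ?lerDr // mulr_ge0.
have b0 : 2 * x1 * (q * M0 * u ^+ 2) <= 2 * q * (x1 * M0) * (u ^+ 2 + v ^+ 2).
  have -> : 2 * x1 * (q * M0 * u ^+ 2) = 2 * q * (x1 * M0) * u ^+ 2 by ring.
  by rewrite ler_wpM2l ?lerDl // mulr_ge0.
have bq : 2 * q * (x0 * M1) * (u ^+ 2 + v ^+ 2) + 2 * q * (x1 * M0) * (u ^+ 2 + v ^+ 2)
   <= c * (u ^+ 2 + v ^+ 2).
  rewrite -mulrDl ler_wpM2r ?addr_ge0 // -qE /K; lra.
by lra.
Qed.

(** A weight that tends to infinity, because the harmonic series diverges, but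
    slowly enough to be absorbed by a contraction rate [kap / (t+1)] as soon as
    [gam <= kap]. *)
Definition growth (gam : R) (t0 t : nat) : R :=
  \prod_(t0 <= s < t) (1 + gam / s.+1%:R).

Lemma growth_ge1 (gam : R) t0 t : 0 <= gam -> 1 <= growth gam t0 t.
Proof.
move=> g0; rewrite /growth big_seq; elim/big_ind: _ => // [x y x1 y1|i _].
  by rewrite mulr_ege1.
by rewrite lerDl divr_ge0.
Qed.

Lemma growthS (gam : R) t0 t : 0 <= gam ->
  growth gam t0 t.+1 <= growth gam t0 t * (1 + gam / t.+1%:R).
Proof.
move=> g0; have [tt|tt] := leqP t0 t; first by rewrite /growth big_nat_recr.
rewrite {1}/growth big_geq // mulr_ege1 ?growth_ge1 // lerDl divr_ge0 //.
Qed.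

Lemma growth_unbounded (gam : R) t0 (B : R) : 0 < gam ->
  exists n, forall t, (n <= t)%N -> B < growth gam t0 t.
Proof.
move=> g0.
have lin t : 1 + gam * (series harmonic t - series harmonic t0) <= growth gam t0 t.
  have [tt|/ltnW tt] := leqP t0 t; last first.
    rewrite /growth big_geq // gerDl mulr_ge0_le0 //; first exact: ltW.
    rewrite subr_le0.
    by apply: nondecreasing_series => // i _; rewrite harmonic_ge0.
  rewrite sub_series_geq // /growth.
  elim: t tt => [|t IH]; first by rewrite leqn0 => /eqP ->; rewrite !big_geq // mulr0 addr0.
  rewrite leq_eqVlt => /orP[/eqP ->|]; first by rewrite !big_geq // mulr0 addr0.
  rewrite ltnS => tt; rewrite !big_nat_recr //=.
  have := IH tt; have : 1 <= growth gam t0 t by apply: growth_ge1; exact: ltW.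
  rewrite /growth /harmonic /=; set S := \sum_(_ <= _ < _) _; set W := \prod_(_ <= _ < _) _.
  have i0 : 0 < (t.+1%:R : R)^-1 by rewrite invr_gt0.
  move=> W1 WS.
  have gi0 : 0 <= gam * t.+1%:R^-1 by rewrite mulr_ge0 // ltW.
  have : gam * t.+1%:R^-1 <= W * (gam * t.+1%:R^-1) by rewrite ler_peMl.
  rewrite !mulrDr mulr1; set j := gam / _; set k := gam * S in WS *; lra.
have [n hn] : exists n, (B - 1) / gam + series harmonic t0 < series harmonic n.
  apply: contrapT => no; apply: (@dvg_harmonic R).
  apply: nondecreasing_is_cvgn.
    by apply: nondecreasing_series => i _; rewrite harmonic_ge0.
  exists ((B - 1) / gam + series harmonic t0) => _ [n _ <-].
  by rewrite leNgt; apply/negP => h; apply: no; exists n.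
exists n => t nt; apply: lt_le_trans (lin t).
have : series harmonic n <= series harmonic t :> R.
  by apply: nondecreasing_series => // i _; rewrite harmonic_ge0.
move=> hh; rewrite -ltrBlDl mulrC -ltr_pdivrMr //; lra.
Qed.

(** The correction [8 C / tau] pays for the noise: when [tau] becomes [tau + 1] it
    loses about [8 C / tau^2], of which the weight takes back at most half since
    [gam <= 1/2]. *)
Lemma weighted_decrease (kap gam C V V' tau : R) : 0 < gam -> gam <= kap -> gam <= 1/2 ->
  0 <= C -> 0 <= V -> 1 <= tau -> V' <= V - kap * V / tau + C / tau ^+ 2 ->
  (1 + gam / tau) * (V' + 8 * C / (tau + 1)) <= V + 8 * C / tau.
Proof.
move=> g0 gk g1 C0 V0 t1 hV'.
have t0 : 0 < tau by lra.
have it0 : 0 < tau^-1 by rewrite invr_gt0.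
have pos : 0 <= 1 + gam / tau by rewrite addr_ge0 // divr_ge0 // ltW.
apply: (@le_trans _ _ ((1 + gam / tau) *
   (V - gam * V / tau + C / tau ^+ 2 + 8 * C / (tau + 1)))).
  rewrite ler_wpM2l // lerD2r; apply: (le_trans hV'); rewrite lerD2r lerD2l lerN2.
  by rewrite ler_pM2r // ler_wpM2r.
rewrite -subr_ge0.
have -> : V + 8 * C / tau - (1 + gam / tau) *
   (V - gam * V / tau + C / tau ^+ 2 + 8 * C / (tau + 1)) =
   gam ^+ 2 * V / tau ^+ 2 +
   C * (8 * (1 - gam) * tau ^+ 2 - (tau + gam) * (tau + 1)) / (tau ^+ 3 * (tau + 1)).
  by field; rewrite !lt0r_neq0 //; lra.
apply: addr_ge0.
  by rewrite divr_ge0 ?sqr_ge0 // mulr_ge0 ?sqr_ge0.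
rewrite divr_ge0 //; last by rewrite mulr_ge0 ?exprn_ge0; lra.
rewrite mulr_ge0 //; nra.
Qed.
End Analysis.

(** * Drift of the Lyapunov function *)

Section Model.
Context (R : realType) (m : nat) (hm : (1 <= m)%N) (p : nat -> R) (mu : 'I_2 -> R).
Hypothesis hp : forall k, (k <= m)%N -> 0 <= p k <= 1.
Hypothesis hmu_pos : forall i, 0 < mu i.
Hypothesis hmu_sum : \sum_i mu i = 1.
Variable g0 : tgraph 2.
Hypothesis hg0 : initial_graph m g0.

Definition regular t (g : tgraph 2) : Prop :=
  valid g /\ forall i, community_deg g i = (community_deg g0 i + m * t)%N.

Lemma regular0 : regular 0 g0.
Proof. by split=> [e /(initial_edges hg0)|i]; rewrite ?muln0 ?addn0. Qed.

Lemma community_deg0_gt0 i : (0 < community_deg g0 i)%N.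
Proof.
have [v cv] := initial_community hg0 i.
rewrite -community_degE /label_deg (bigD1 v) /=; last by rewrite -cv.
by rewrite addn_gt0 (initial_deg hg0).
Qed.

Lemma regular_deg_gt0 t g : regular t g -> forall i, (0 < community_deg g i)%N.
Proof. by move=> [_ tg] i; rewrite tg addn_gt0 community_deg0_gt0. Qed.

Lemma regular_step t g y (w : m.-tuple (vertex g)) b : regular t g ->
  step_prob (cross_attractiveness R) mu p y w b != 0 -> regular t.+1 (add_vertex y w b).
Proof.
move=> [vg tg] /step_prob_neq0[_ wy]; split; first exact: valid_add.
have hw v (vw : v \in w) := (wy v vw).1.
have [cy cr cb] := colour_deg_step b vg hw; move=> i.
have [->|] := eqVneq i y.
  have := tg y; rewrite /community_deg !cy mulnS.
  by case: b {cy cr cb} => /=; lia.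
rewrite neq_other => /eqP ->; have := tg (other y).
by rewrite /community_deg cr cb mulnS; have := count_le_size w; lia.
Qed.

Lemma colour_deg_regular_step t g y (w : m.-tuple (vertex g)) b : regular t g ->
  step_prob (cross_attractiveness R) mu p y w b != 0 ->
  [/\ forall c, colour_deg (add_vertex y w b) y c = (colour_deg g y c + m * (b == c))%N,
      colour_deg (add_vertex y w b) (other y) true =
        (colour_deg g (other y) true + count (@is_red 2 g) w)%N &
      colour_deg (add_vertex y w b) (other y) false =
        (colour_deg g (other y) false + (m - count (@is_red 2 g) w))%N].
Proof. by move=> [vg _] /step_prob_neq0[_ wy]; apply: colour_deg_step => // v /wy[]. Qed.

Let f := rule_poly m p.
Variables (a q : 'I_2 -> R).
Hypothesis a01 : forall i, 0 <= a i <= 1.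
Hypothesis q_gt0 : forall i, 0 < q i.

Local Notation Z := (red_proportion R).

Definition lyapunov (g : tgraph 2) : R := \sum_i q i * (Z g i - a i) ^+ 2.

Lemma lyapunov_ge0 g : 0 <= lyapunov g.
Proof. by apply: sumr_ge0 => i _; rewrite mulr_ge0 ?sqr_ge0 // ltW. Qed.

(** Step size of the proportion in community [i]: the [m] new edge-ends over the
    new total degree.  It is [1 / (t+1)] up to [O(1 / t^2)], for both
    communities. *)
Definition rate t i : R := m%:R / (community_deg g0 i + m * t.+1)%:R.

Lemma rate_itv t i : 0 <= rate t i /\
  - ((community_deg g0 i)%:R / t.+1%:R ^+ 2) <= rate t i - t.+1%:R^-1 <= 0.
Proof.
split; first by rewrite divr_ge0.
have t0 : 0 < t.+1%:R :> R by [].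
have m1 : 1 <= m%:R :> R by rewrite ler1n.
have D0 : 0 < (community_deg g0 i)%:R :> R by rewrite ltr0n community_deg0_gt0.
rewrite /rate natrD natrM; set D := (community_deg g0 i)%:R in D0 *; set s := t.+1%:R in t0 *.
have ms : 0 < m%:R * s by rewrite mulr_gt0 //; lra.
have -> : m%:R / (D + m%:R * s) - s^-1 = - (D / ((D + m%:R * s) * s)).
  by field; rewrite !lt0r_neq0 //; lra.
rewrite lerN2 oppr_le0 divr_ge0 ?andbT; [|lra|by rewrite mulr_ge0; lra].
rewrite ler_pM2l // lef_pV2 ?posrE ?exprn_gt0 ?mulr_gt0 //; last by lra.
by rewrite expr2 ler_pM2r //; nra.
Qed.

Lemma rate_le t i : rate t i <= t.+1%:R^-1.
Proof. by have [_ /andP[_]] := rate_itv t i; rewrite subr_le0. Qed.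

Lemma proportion_step t g y (w : m.-tuple (vertex g)) b : regular t g ->
  step_prob (cross_attractiveness R) mu p y w b != 0 ->
  Z (add_vertex y w b) y = Z g y + rate t y * (b%:R - Z g y) /\
  Z (add_vertex y w b) (other y) = Z g (other y) +
    rate t (other y) * ((count (@is_red 2 g) w)%:R / m%:R - Z g (other y)).
Proof.
move=> rg s0; have rg' := regular_step rg s0.
have [cy cr _] := colour_deg_regular_step rg s0.
have m0 : m%:R != 0 :> R by rewrite pnatr_eq0 -lt0n.
have tot s g' i : regular s g' ->
    (community_deg g' i)%:R = (community_deg g0 i)%:R + m%:R * s%:R :> R.
  by case=> _ ->; rewrite natrD natrM.
have pos s i : (community_deg g0 i)%:R + m%:R * s%:R != 0 :> R.
  by rewrite -natrM -natrD pnatr_eq0 -lt0n addn_gt0 community_deg0_gt0.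
have rE i : rate t i = m%:R / ((community_deg g0 i)%:R + m%:R * t.+1%:R).
  by rewrite /rate natrD natrM.
rewrite !red_proportionE !(tot _ _ _ rg) !(tot _ _ _ rg') !rE cy cr.
rewrite (natrD R (colour_deg g y true)) (natrD R (colour_deg g (other y) true)) natrM.
have pos' i := pos t.+1 i; rewrite -[t.+1%:R]natr1 in pos' *.
have eb : (b == true)%:R = b%:R :> R by case: b {s0 rg' cy cr}.
rewrite eb; move: (pos t y) (pos' y) (pos t (other y)) (pos' (other y)).
move: (community_deg g0 y)%:R (community_deg g0 (other y))%:R => D1 D2 h1 h1' h2 h2'.
by split; field; rewrite ?m0 ?h1 ?h1' ?h2 ?h2'.
Qed.

(** Expanding the squares: the linear terms average to the mean flow, and the
    quadratic ones are at most the squared step size. *)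
Lemma mean_step_lyapunov t g : regular t g ->
  mean_step m p mu lyapunov g <= lyapunov g +
    \sum_y 2 * mu y * q y * rate t y * (Z g y - a y) * (f.[Z g (other y)] - Z g y)
    + (\sum_y q y) / t.+1%:R ^+ 2.
Proof.
move=> rg.
have m0 : m%:R != 0 :> R by rewrite pnatr_eq0 -lt0n.
pose dev y k (b : bool) : R := lyapunov g
  + 2 * q y * (Z g y - a y) * rate t y * (b%:R - Z g y)
  + 2 * q (other y) * (Z g (other y) - a (other y)) * rate t (other y) *
     (k%:R / m%:R - Z g (other y)) + (\sum_i q i) / t.+1%:R ^+ 2.
apply: (le_trans (mean_step_le hp hmu_pos (phi := dev) (regular_deg_gt0 rg) _)).
  move=> y w b s0; have [Zy Zo] := proportion_step rg s0.
  rewrite /dev /lyapunov !(sum_other _ y) Zy Zo.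
  (* [x - z] is a difference of two proportions, so the noise is at most the
     squared step size. *)
  have sq (r z x : R) : 0 <= r <= t.+1%:R^-1 -> 0 <= z <= 1 -> 0 <= x <= 1 ->
      (r * (x - z)) ^+ 2 <= (t.+1%:R ^+ 2)^-1.
    move=> /andP[r0 r1] hz hx; rewrite exprMn -exprVn -[leRHS]mulr1.
    apply: ler_pM; rewrite ?sqr_ge0 //; first by rewrite lerXn2r ?nnegrE // (le_trans r0).
    by rewrite -[leRHS](expr1n _ 2) -real_normK ?num_real // lerXn2r ?nnegrE // ler_norml; lra.
  have hr i : 0 <= rate t i <= t.+1%:R^-1 by rewrite rate_le andbT; have [] := rate_itv t i.
  have hb : 0 <= (b%:R : R) <= 1 by case: (b); rewrite ?lexx ler01.
  have hk : 0 <= ((count (@is_red 2 g) w)%:R / m%:R : R) <= 1.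
    rewrite divr_ge0 //= ler_pdivrMr ?ltr0n // mul1r ler_nat; exact: count_le_size.
  have s1 := sq _ _ _ (hr y) (red_proportion_itv R g y) hb.
  have s2 := sq _ _ _ (hr (other y)) (red_proportion_itv R g (other y)) hk.
  have := ler_wpM2l (ltW (q_gt0 y)) s1; have := ler_wpM2l (ltW (q_gt0 (other y))) s2.
  move: (rate t y) (rate t (other y)) (Z g y) (Z g (other y)) => r1 r2 z1 z2.
  move: (q y) (q (other y)) (a y) (a (other y)) (_ ^- 2) => q1 q2 a1 a2 T0.
  move: (b%:R) (_ / _) => x1 x2.
  by lra.
have -> : lyapunov g
    + \sum_y 2 * mu y * q y * rate t y * (Z g y - a y) * (f.[Z g (other y)] - Z g y)
    + (\sum_y q y) / t.+1%:R ^+ 2 = \sum_y mu y * (lyapunov g +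
   2 * q y * rate t y * (Z g y - a y) * (f.[Z g (other y)] - Z g y)
    + (\sum_y q y) / t.+1%:R ^+ 2).
  under [RHS]eq_bigr => y _ do rewrite 2!mulrDr.
  rewrite !big_split /= -!mulr_suml hmu_sum !mul1r; congr (_ + _ + _).
  by apply: eq_bigr => y _; ring.
rewrite le_eqVlt; apply/orP; left; apply/eqP; apply: eq_bigr => y _; congr (_ * _).
have -> : (fun k => p k * dev y k true + (1 - p k) * dev y k false) = (fun k =>
   (lyapunov g - 2 * q y * (Z g y - a y) * rate t y * Z g y
   - 2 * q (other y) * (Z g (other y) - a (other y)) * rate t (other y) * Z g (other y)
   + (\sum_i q i) / t.+1%:R ^+ 2)
   + 2 * q y * (Z g y - a y) * rate t y * p k
   + 2 * q (other y) * (Z g (other y) - a (other y)) * rate t (other y) / m%:R * k%:R).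
  by apply/funext => k; rewrite /dev /=; ring.
rewrite (rule_poly_affine m p (fun k => k%:R)) rule_poly_natr -/f.
by rewrite [X in _ + X = _]mulrA (divfK m0); ring.
Qed.

(** Replacing both step sizes by the common value [1 / (t+1)] makes the drift a
    multiple of the mean flow, weighted by [mu y * q y]. *)
Lemma mean_step_lyapunov_drift t g : regular t g ->
  mean_step m p mu lyapunov g <= lyapunov g +
    (\sum_y 2 * (mu y * q y) * (Z g y - a y) * (f.[Z g (other y)] - Z g y)) / t.+1%:R
    + (\sum_y (q y + 2 * (mu y * q y) * (community_deg g0 y)%:R)) / t.+1%:R ^+ 2.
Proof.
move=> rg; apply: (le_trans (mean_step_lyapunov rg)).
rewrite big_split /= mulrDl [X in _ <= _ + X]addrC addrA lerD2r -addrA lerD2l.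
rewrite !mulr_suml -big_split /=; apply: ler_sum => y _.
have [r0] := rate_itv t y; move: (rate t y) => r /andP[rl ru].
have := rule_poly_itv hp (red_proportion_itv R g (other y)); rewrite -/f.
have := red_proportion_itv R g y; have := a01 y.
move: (Z g y) (f.[_]) (a y) => z w c hc hz hw.
have x0 : 0 < mu y * q y by rewrite mulr_gt0.
set D := (community_deg g0 y)%:R / _ in rl.
have D0 : 0 <= D by rewrite divr_ge0 // exprn_ge0.
have e : `|(r - t.+1%:R^-1) * ((z - c) * (w - z))| <= D * 1.
  rewrite normrM; apply: ler_pM => //; first by rewrite ler_norml rl (le_trans ru).
  by rewrite normrM -[leRHS]mulr1; apply: ler_pM => //; rewrite ler_norml; lra.
have := ler_wpM2l (ltW x0) (le_trans (ler_norm _) e).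
rewrite /D; set s := t.+1%:R^-1; set s2 := (_ ^+ 2)^-1; move: (community_deg g0 y)%:R => T0.
by lra.
Qed.

End Model.

(** * Convergence from a nearby start *)

Section Main.
Context (R : realType) (m : nat) (hm : (1 <= m)%N) (p : nat -> R) (mu : 'I_2 -> R).
Hypothesis hp : forall k, (k <= m)%N -> 0 <= p k <= 1.
Hypothesis hmu_pos : forall i, 0 < mu i.
Hypothesis hmu_sum : \sum_i mu i = 1.
Variable g0 : tgraph 2.
Hypothesis hg0 : initial_graph m g0.
Context d (T : measurableType d) (P : probability T R).
Context (G : nat -> T -> tgraph 2).
Hypothesis hG : attachment_process P (cross_attractiveness R) mu m p g0 G.

Let f := rule_poly m p.
Local Notation Z := (red_proportion R).

Variable a : 'I_2 -> R.
Hypothesis a01 : forall i, 0 <= a i <= 1.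
Hypothesis fa : forall i, f.[a (other i)] = a i.

Lemma lyapunov_contraction : (forall i, f^`().[a (other i)] * f^`().[a i] < 1) ->
  exists (q : 'I_2 -> R) (kap eps C : R), [/\ forall i, 0 < q i, 0 < kap, 0 < eps, 0 <= C &
    forall t g, regular m g0 t g -> lyapunov a q g < eps ->
    mean_step m p mu (lyapunov a q) g <=
      lyapunov a q g - kap * lyapunov a q g / t.+1%:R + C / t.+1%:R ^+ 2].
Proof.
move=> df; pose y : 'I_2 := ord0.
have fy := fa (other y); rewrite rev_ordK in fy.
have [x0 [x1 [c [r [[x00 x10 c0 r0] hd]]]]] := local_drift (fa y) fy (df y).
pose x i := if i == y then x0 else x1.
pose q i := x i / mu i.
have x_gt0 i : 0 < x i by rewrite /x; case: ifP.
have q_gt0 i : 0 < q i by rewrite divr_gt0.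
have xE i : mu i * q i = x i by rewrite mulrC divfK // gt_eqF.
pose Q := \sum_i q i.
have Q0 : 0 < Q by rewrite /Q (sum_other _ y) addr_gt0.
(* Below this level of the quadratic form both deviations are at most [r]. *)
pose eps := Num.min (q y * r ^+ 2) (q (other y) * r ^+ 2).
exists q, (c / Q), eps, (\sum_i (q i + 2 * (mu i * q i) * (community_deg g0 i)%:R)).
split=> //.
- by rewrite divr_gt0.
- by rewrite lt_min; apply/andP; split; rewrite mulr_gt0 ?exprn_gt0.
- apply: sumr_ge0 => i _; apply: addr_ge0; first exact: ltW.
  by rewrite mulr_ge0 // xE mulr_ge0 // ltW.
move=> t g rg Ve.
apply: (le_trans (mean_step_lyapunov_drift hm hp hmu_pos hmu_sum hg0 a01 q_gt0 rg)).
rewrite lerD2r lerD2l -mulNr ler_pM2r ?invr_gt0 // -/f.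
move: Ve; rewrite /lyapunov (sum_other _ y) (sum_other _ y) !xE rev_ordK.
rewrite /x eqxx (negbTE (other_neq y)).
set u := Z g y - a y; set v := Z g (other y) - a (other y).
rewrite lt_min => /andP[V0 V1].
have u2 := sqr_ge0 u; have v2 := sqr_ge0 v.
have qu : 0 <= q y * u ^+ 2 by rewrite mulr_ge0 // ltW.
have qv : 0 <= q (other y) * v ^+ 2 by rewrite mulr_ge0 // ltW.
have le_r w : w ^+ 2 < r ^+ 2 -> `|w| <= r.
  by move=> h; rewrite -ler_sqr ?nnegrE ?(ltW r0) // real_normK ?num_real // ltW.
have ur : `|u| <= r by apply: le_r; rewrite -(ltr_pM2l (q_gt0 y)); lra.
have vr : `|v| <= r by apply: le_r; rewrite -(ltr_pM2l (q_gt0 (other y))); lra.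
have := hd u v ur vr.
have -> : a y + u = Z g y by rewrite /u addrC subrK.
have -> : a (other y) + v = Z g (other y) by rewrite /v addrC subrK.
have VQ : q y * u ^+ 2 + q (other y) * v ^+ 2 <= Q * (u ^+ 2 + v ^+ 2).
  rewrite /Q (sum_other _ y); have := q_gt0 y; have := q_gt0 (other y); nra.
have cQ : 0 < c / Q by rewrite divr_gt0.
have : c / Q * (q y * u ^+ 2 + q (other y) * v ^+ 2) <= c * (u ^+ 2 + v ^+ 2).
  apply: le_trans (ler_wpM2l (ltW cQ) VQ) _.
  by rewrite mulrA divfK // gt_eqF.
by move=> h1 h2; apply: (le_trans h2); rewrite mulNr lerN2.
Qed.

Definition reachable t (g : tgraph 2) : Prop :=
  regular m g0 t g /\ exists2 H, history_event G t g H & (0 < P H)%E.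

Lemma reachable0 : reachable 0 g0.
Proof.
split; first exact: regular0.
by exists setT; [exact: history0 hG|rewrite probability_setT lte01].
Qed.

Lemma reachable_step t g y (w : m.-tuple (vertex g)) b : reachable t g ->
  0 < step_prob (cross_attractiveness R) mu p y w b -> reachable t.+1 (add_vertex y w b).
Proof.
move=> [rg [H hH PH]] s0; split; first exact: regular_step (lt0r_neq0 s0).
have [PE hH'] := history_step hG y w b hH; eexists; first exact: hH'.
by rewrite PE mule_gt0 // lte_fin.
Qed.

Definition converge_event := [set x : T | forall i, Z (G t x) i @[t --> \oo] --> a i].

(** The good event asks for [w_t V_t < eps] with a growing weight [w_t], rather
    than for [V_t < eps]: staying in it for ever already means convergence. *)
Lemma local_convergence (q : 'I_2 -> R) (kap eps C : R) :
  (forall i, 0 < q i) -> 0 < kap -> 0 < eps -> 0 <= C ->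
  (forall t g, regular m g0 t g -> lyapunov a q g < eps ->
    mean_step m p mu (lyapunov a q) g <=
      lyapunov a q g - kap * lyapunov a q g / t.+1%:R + C / t.+1%:R ^+ 2) ->
  (exists t g, reachable t g /\ lyapunov a q g + 8 * C / t.+1%:R < eps) ->
  exists A : set T, [/\ measurable A, (0 < P A)%E & A `<=` converge_event].
Proof.
move=> q_gt0 kap0 eps0 C0 hV [t0 [g [[rg [H hH PH]] Vg]]].
pose gam := Num.min kap (1 / 2).
have gam0 : 0 < gam by rewrite lt_min kap0 divr_gt0.
have gamk : gam <= kap by rewrite ge_min lexx.
have gam2 : gam <= 1 / 2 by rewrite ge_min lexx orbT.
pose w := growth gam t0.
have w1 t : 1 <= w t by apply: growth_ge1; exact: ltW.
have w0 t : 0 < w t by exact: lt_le_trans (w1 t).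
have V0 h : 0 <= lyapunov a q h by exact: lyapunov_ge0.
have N0 t : 0 <= 8 * C / t.+1%:R by rewrite divr_ge0 // mulr_ge0.
(* The trailing factor 1 exhibits a linear combination with a constant
   function, as needed to average it. *)
pose F t h := w t / eps * lyapunov a q h + w t / eps * (8 * C / t.+1%:R) * 1.
pose good t h := w t * lyapunov a q h < eps.
exists [set x | forall s, (t0 <= s)%N -> regular m g0 s (G s x) /\ good s (G s x)].
split.
- exact: (measurable_path_event hG (leq t0)
    (fun s h => regular m g0 s h /\ good s h)).
- apply: (stays_good_forever hmu_sum hG (Inv := regular m g0)
      (good := good) (f := F) _ _ _ _ _ hH rg _ PH).
  + by move=> t h y u b; exact: regular_step.
  + by move=> t h; exact: regular_deg_gt0.
  + by move=> t h; rewrite /F mulr1 addr_ge0 // mulr_ge0 // divr_ge0 // ltW.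
  + move=> t h _ /negP; rewrite -leNgt => le_w; rewrite /F mulr1.
    apply: (@le_trans _ _ (w t / eps * lyapunov a q h)).
      by rewrite mulrAC ler_pdivlMr // mul1r.
    by rewrite lerDl mulr_ge0 // divr_ge0 // ltW.
  + move=> t h rh gh; rewrite mean_stepD mean_step_cst //; last exact: regular_deg_gt0 rh.
    rewrite /F !mulr1 -!mulrDr.
    have Ve : lyapunov a q h < eps by apply: le_lt_trans gh; rewrite ler_peMl.
    have := hV _ _ rh Ve; set V' := mean_step _ _ _ _ _ => hV'.
    have V'0 : 0 <= V'.
      rewrite /V' /mean_step; do 3!(apply: sumr_ge0 => ? _).
      by rewrite mulr_ge0 // step_prob_ge0.
    apply: (@le_trans _ _ (w t / eps * ((1 + gam / t.+1%:R) * (V' + 8 * C / t.+2%:R)))).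
      rewrite mulrA; apply: ler_wpM2r; first exact: addr_ge0.
      rewrite [leRHS]mulrAC; apply: ler_wpM2r; first by rewrite invr_ge0 ltW.
      by apply: growthS; exact: ltW.
    apply: ler_wpM2l; first by rewrite divr_ge0 // ltW.
    have := weighted_decrease gam0 gamk gam2 C0 (V0 h) _ hV'.
    by rewrite -[t.+2%:R]natr1; apply; rewrite ler1n.
  + rewrite /F /w /growth big_geq // mulr1 -mulrDr mulrC mulrA mulr1.
    by rewrite ltr_pdivrMr // mul1r.
move=> x hx i; apply/cvgrPdist_lt => e e0.
have [n hn] := growth_unbounded t0 (eps / (q i * e ^+ 2)) gam0.
exists (maxn n t0) => // s /=; rewrite geq_max => /andP[ns ts].
have [_ gs] := hx s ts; have := hn s ns; rewrite -/(w s).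
have qe : 0 < q i * e ^+ 2 by rewrite mulr_gt0 // exprn_gt0.
rewrite ltr_pdivrMr // => we.
have Vi : q i * (Z (G s x) i - a i) ^+ 2 <= lyapunov a q (G s x).
  rewrite /lyapunov (bigD1 i) //= lerDl sumr_ge0 // => j _.
  by rewrite mulr_ge0 ?sqr_ge0 // ltW.
have : q i * (Z (G s x) i - a i) ^+ 2 < q i * e ^+ 2.
  apply: (le_lt_trans Vi); rewrite -(ltr_pM2l (w0 s)).
  exact: lt_trans gs we.
rewrite ltr_pM2l // distrC => h.
by rewrite -ltr_sqr ?nnegrE ?(ltW e0) // real_normK ?num_real.
Qed.

(** * Steering the process towards the two-cycle *)
Definition interior (g : tgraph 2) := forall i c, (0 < colour_deg g i c)%N.

Lemma reachable_choice t g y k b : reachable t g -> (k <= m)%N ->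
  ((0 < k)%N -> (0 < colour_deg g (other y) true)%N) ->
  ((k < m)%N -> (0 < colour_deg g (other y) false)%N) ->
  0 < (if b then p k else 1 - p k) ->
  exists g', [/\ reachable t.+1 g',
      forall c, colour_deg g' y c = (colour_deg g y c + m * (b == c))%N,
      colour_deg g' (other y) true = (colour_deg g (other y) true + k)%N &
      colour_deg g' (other y) false = (colour_deg g (other y) false + (m - k))%N].
Proof.
move=> rg km hr hb hk; have [w [cw sw]] := step_choice hmu_pos km hr hb hk.
exists (add_vertex y w b).
have [c1 c2 c3] := colour_deg_regular_step rg.1 (lt0r_neq0 sw).
by split=> //; rewrite -?cw //; exact: reachable_step.
Qed.

(** The edge-ends move on average by [m * a] when the red proportions are [a], so
    the point to follow at time [t] is [m * a * t]. *)
Definition ray_dist y t (g : tgraph 2) : R :=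
  ((colour_deg g y true)%:R - m%:R * a y * t%:R) ^+ 2 +
  ((colour_deg g (other y) true)%:R - m%:R * a (other y) * t%:R) ^+ 2.

Lemma convex_le (r x1 x2 c : R) : 0 <= r <= 1 -> r * x1 + (1 - r) * x2 <= c ->
  exists b : bool, 0 < (if b then r else 1 - r) /\ (if b then x1 else x2) <= c.
Proof.
move=> /andP[r0 r1] h; have [x1c|x1c] := leP x1 c.
  have [rp|rz] := ltP 0 r; first by exists true.
  have r00 : r = 0 by apply/eqP; rewrite eq_le rz r0.
  by exists false; rewrite r00 subr0 ltr01; move: h; rewrite r00 mul0r add0r subr0 mul1r.
exists false; have [x2c|x2c] := leP x2 c; last first.
  exfalso; have h2 : 0 <= (1 - r) * (x2 - c) by rewrite mulr_ge0 ?subr_ge0 // ltW.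
  have [rp|rz] := ltP 0 r; last by nra.
  have : 0 < r * (x1 - c) by rewrite mulr_gt0 ?subr_gt0.
  by lra.
split=> //; rewrite subr_gt0 lt_neqAle r1 andbT; apply/eqP => re.
by move: h; rewrite re subrr mul0r addr0 mul1r leNgt x1c.
Qed.

(** At [a] the mean increment, for a newcomer to [y], is the increment of the
    point followed, so on average the squared distance grows only by the
    variance of the step, and some outcome does no worse than the average.  In
    a two-coloured state all the outcomes that occur at [a] are possible. *)
Lemma greedy_step y t g : reachable t g -> interior g ->
  exists g', [/\ reachable t.+1 g', interior g' &
    ray_dist y t.+1 g' <= ray_dist y t g + 2 * m%:R ^+ 2].
Proof.
move=> rg ig; set L := ray_dist y t g + _.
pose A := (colour_deg g y true)%:R - m%:R * a y * t%:R.
pose B := (colour_deg g (other y) true)%:R - m%:R * a (other y) * t%:R.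
pose psi (k : nat) (b : bool) : R :=
  (A + m%:R * (b%:R - a y)) ^+ 2 + (B + (k%:R - m%:R * a (other y))) ^+ 2.
have m0 : 0 <= m%:R :> R by [].
have hpsi k b : (k <= m)%N -> psi k b <=
    L + 2 * A * m%:R * (b%:R - a y) + 2 * B * (k%:R - m%:R * a (other y)).
  move=> km.
  have h1 : (m%:R * (b%:R - a y)) ^+ 2 <= m%:R ^+ 2.
    rewrite exprMn ler_piMr ?sqr_ge0 // -real_normK ?num_real // exprn_ile1 //.
    by have /andP[y0 y1] := a01 y; rewrite ler_norml; case: b {psi} => /=; apply/andP; split; lra.
  have h2 : (k%:R - m%:R * a (other y)) ^+ 2 <= m%:R ^+ 2.
    rewrite -real_normK ?num_real // lerXn2r ?nnegrE //.
    have k0 : 0 <= k%:R :> R by [].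
    have k1 : k%:R <= m%:R :> R by rewrite ler_nat.
    have /andP[ao0 ao1] := a01 (other y).
    have ma0 : 0 <= m%:R * a (other y) by rewrite mulr_ge0.
    have ma1 : m%:R * a (other y) <= m%:R by rewrite ler_piMr.
    rewrite ler_norml; apply/andP; split; lra.
  rewrite /psi /L /ray_dist -/A -/B; lra.
have := le_rule_poly (psi := fun k =>
   (L - 2 * A * m%:R * a y - 2 * B * (m%:R * a (other y))) + (2 * A * m%:R) * p k
     + (2 * B) * k%:R)
   (phi := fun k => p k * psi k true + (1 - p k) * psi k false) (a01 (other y)) (m := m).
rewrite (rule_poly_affine m p (fun k => k%:R)) rule_poly_natr -/f fa => hle.
have hle2 : (rule_poly m (fun k =>
    p k * psi k true + (1 - p k) * psi k false)).[a (other y)] <= L.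
  apply: le_trans (hle _) _; last by lra.
  move=> k km; have /andP[p0 p1] := hp km.
  have q0 : 0 <= 1 - p k by rewrite subr_ge0.
  have := ler_wpM2l p0 (hpsi k true km); have := ler_wpM2l q0 (hpsi k false km) => /=.
  lra.
have [k km /(convex_le (hp km)) [b [hb psib]]] := rule_poly_pick (a01 (other y)) hle2.
have [g' [rg' c1 c2 c3]] := reachable_choice (y := y) rg km (fun=> ig _ _) (fun=> ig _ _) hb.
exists g'; split=> //.
  move=> i c; have [->|] := eqVneq i y; first by rewrite c1 addn_gt0 ig.
  by rewrite neq_other => /eqP ->; case: c; rewrite ?c2 ?c3 addn_gt0 ig.
have -> : ray_dist y t.+1 g' = psi k b.
  rewrite /ray_dist c1 c2 /psi /A /B.
  rewrite (natrD R (colour_deg g y true)) (natrD R (colour_deg g (other y) true)).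
  by rewrite natrM -natr1 eqb_id; ring.
by move: psib; case: b {hb rg' c1 c2 c3}.
Qed.

Lemma greedy_path y t g n : reachable t g -> interior g ->
  exists g', [/\ reachable (n + t) g', interior g' &
    ray_dist y (n + t) g' <= ray_dist y t g + 2 * m%:R ^+ 2 * n%:R].
Proof.
move=> rg ig; elim: n => [|n [g1 [r1 i1 L1]]].
  by exists g; rewrite add0n mulr0 addr0.
have [g2 [r2 i2 L2]] := greedy_step y r1 i1; exists g2; split=> //.
by rewrite -natr1; apply: (le_trans L2); lra.
Qed.

(** The squared distance to the ray is of order [t], and dividing by the square
    of the total degree leaves [O(1 / t)]. *)
Lemma reachable_near (q : 'I_2 -> R) (C eps : R) t g : (forall i, 0 < q i) ->
  0 <= C -> 0 < eps -> reachable t g -> interior g ->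
  exists t' g', reachable t' g' /\ lyapunov a q g' + C / t'.+1%:R < eps.
Proof.
move=> q_gt0 C0 eps0 rg ig; pose y : 'I_2 := ord0.
have m1 : 1 <= m%:R :> R by rewrite ler1n.
pose D : R := (community_deg g0 y)%:R ^+ 2 + (community_deg g0 (other y))%:R ^+ 2.
pose L1 := ray_dist y t g.
have L10 : 0 <= L1 by rewrite addr_ge0 ?sqr_ge0.
pose Q := q y + q (other y).
pose K := Q * (2 * (L1 + 2 * m%:R ^+ 2) + 2 * D) + C.
have D0 : 0 <= D by rewrite addr_ge0 ?sqr_ge0.
have Q0 : 0 < Q by rewrite addr_gt0.
have K0 : 0 <= K.
  apply: addr_ge0 => //; apply: mulr_ge0; first exact: ltW.
  by have m20 := sqr_ge0 (m%:R : R); lra.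
have [n hn] : exists n : nat, K / eps < n%:R.
  by exists (Num.bound (K / eps)); rewrite archi_boundP // divr_ge0 // ltW.
pose s := (n.+1 + t)%N.
have [g' [rg' ig' Lg']] := greedy_path y n.+1 rg ig; rewrite -/s in rg' Lg'.
exists s, g'; split=> //.
have s0 : 0 < s%:R :> R by rewrite ltr0n.
have s1 : 1 <= s%:R :> R by rewrite ler1n.
have ns : (n.+1)%:R <= s%:R :> R by rewrite ler_nat leq_addr.
have Ls : ray_dist y s g' <= (L1 + 2 * m%:R ^+ 2) * s%:R.
  apply: (le_trans Lg'); rewrite [leRHS]mulrDl -/L1.
  apply: lerD; first by rewrite ler_peMr.
  by rewrite ler_wpM2l // mulr_ge0 ?sqr_ge0.
have dev i : (Z g' i - a i) ^+ 2 <=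
   (2 * ((colour_deg g' i true)%:R - m%:R * a i * s%:R) ^+ 2
     + 2 * (community_deg g0 i)%:R ^+ 2) / s%:R ^+ 2.
  have tE : (community_deg g' i)%:R = (community_deg g0 i)%:R + m%:R * s%:R :> R.
    by rewrite (rg'.1.2 i) natrD natrM.
  have T0 : 0 <= (community_deg g0 i)%:R :> R by [].
  rewrite red_proportionE tE; move: (colour_deg g' i true)%:R => X.
  move: (community_deg g0 i)%:R T0 {tE} => T0 T00.
  have De : s%:R <= T0 + m%:R * s%:R by nra.
  have De0 : 0 < T0 + m%:R * s%:R by exact: lt_le_trans De.
  have -> : X / (T0 + m%:R * s%:R) - a i =
     (X - m%:R * a i * s%:R - a i * T0) / (T0 + m%:R * s%:R).
    by field; rewrite gt_eqF.
  rewrite exprMn exprVn; apply: ler_pM; rewrite ?invr_ge0 ?sqr_ge0 //.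
    set x := X - _; have := sqr_ge0 (x + a i * T0).
    have : (a i * T0) ^+ 2 <= T0 ^+ 2.
      rewrite exprMn ler_piMl ?sqr_ge0 // exprn_ile1 //; by have /andP[] := a01 i.
    move: (a i * T0) => b; lra.
  by rewrite lef_pV2 ?posrE ?exprn_gt0 // lerXn2r ?nnegrE ?(ltW s0) ?(ltW De0).
have Vs : lyapunov a q g' <= Q * (2 * (L1 + 2 * m%:R ^+ 2) + 2 * D) / s%:R.
  rewrite /lyapunov (sum_other _ y).
  have sumle : ((2 * ((colour_deg g' y true)%:R - m%:R * a y * s%:R) ^+ 2
     + 2 * (community_deg g0 y)%:R ^+ 2)
     + (2 * ((colour_deg g' (other y) true)%:R - m%:R * a (other y) * s%:R) ^+ 2
     + 2 * (community_deg g0 (other y))%:R ^+ 2))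
     / s%:R ^+ 2 <= (2 * (L1 + 2 * m%:R ^+ 2) + 2 * D) / s%:R.
    rewrite ler_pdivrMr ?exprn_gt0 // [s%:R ^+ 2]expr2 [leRHS]mulrA divfK ?gt_eqF //.
    have : D <= D * s%:R by rewrite ler_peMr.
    by move: Ls; rewrite /ray_dist /D; lra.
  apply: le_trans (_ : Q * ((Z g' y - a y) ^+ 2 + (Z g' (other y) - a (other y)) ^+ 2) <= _).
    have := sqr_ge0 (Z g' y - a y); have := sqr_ge0 (Z g' (other y) - a (other y)).
    rewrite /Q; have := q_gt0 y; have := q_gt0 (other y); nra.
  rewrite -mulrA ler_pM2l //; apply: le_trans sumle.
  by rewrite mulrDl; apply: lerD; exact: dev.
apply: (@le_lt_trans _ _ (K / s%:R)).
  rewrite /K mulrDl; apply: lerD => //.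
  by apply: ler_wpM2l => //; rewrite lef_pV2 ?posrE // ler_nat.
rewrite ltr_pdivrMr // mulrC -ltr_pdivrMr //.
by apply: (lt_le_trans hn); apply: le_trans ns; rewrite ler_nat.
Qed.

End Main.

(** * Leaving monochromatic states *)

Section Start.
Context (R : realType) (m : nat) (hm : (1 <= m)%N) (p : nat -> R) (mu : 'I_2 -> R).
Hypothesis hp : forall k, (k <= m)%N -> 0 <= p k <= 1.
Hypothesis hmu_pos : forall i, 0 < mu i.
Hypothesis hmu_sum : \sum_i mu i = 1.
Variable g0 : tgraph 2.
Hypothesis hg0 : initial_graph m g0.
Context d (T : measurableType d) (P : probability T R).
Context (G : nat -> T -> tgraph 2).
Hypothesis hG : attachment_process P (cross_attractiveness R) mu m p g0 G.

Local Notation reachable := (reachable m g0 P G).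
Local Notation Z := (red_proportion R).
Let colour_prob (c : bool) k : R := if c then p k else 1 - p k.

(** A community with both colours lets newcomers to the other one see any number
    of red neighbours, in particular a number for which the missing colour has
    positive probability. *)
Lemma mixed_interior t g i :
  (forall c, exists2 k, (k <= m)%N & 0 < colour_prob c k) ->
  reachable t g -> (forall c, 0 < colour_deg g i c)%N ->
  exists t' g', reachable t' g' /\ interior g'.
Proof.
move=> both rg hi; have [h|] := pselect (forall c, 0 < colour_deg g (other i) c)%N.
  exists t, g; split=> // j c; have [->|] := eqVneq j i => //.
  by rewrite neq_other => /eqP ->.
move=> /existsNP[c /negP]; rewrite -leqNgt leqn0 => /eqP c0.
have [k km kp] := both c.
have tot := regular_deg_gt0 hg0 rg.1 (other i).
have hj c' : (0 < colour_deg g (other (other i)) c')%N by rewrite rev_ordK.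
have [g' [rg' c1 c2 c3]] := reachable_choice hm hmu_pos hG rg km (fun=> hj _) (fun=> hj _) kp.
rewrite rev_ordK in c2 c3.
exists t.+1, g'; split=> // j c'; have [->|] := eqVneq j i.
  by case: c'; rewrite ?c2 ?c3 addn_gt0 hi.
rewrite neq_other => /eqP ->; rewrite c1 addn_gt0.
have [_|cc] := eqVneq c c'; first by rewrite muln1 hm orbT.
suff -> : (0 < colour_deg g (other i) c')%N by [].
by move: tot; rewrite /community_deg; case: c c0 cc {kp c1} => ->; case: c' => //; rewrite ?addn0.
Qed.

(** If both communities are monochromatic, a newcomer to [i] sees only the colour
    of the other community.  When it can take the colour missing in [i], that
    community gets both colours.  When neither community can change, equal
    colours are excluded by [not_absorbed], and opposite colours force
    [p 0 = 1] and [p m = 0]. *)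
Lemma interior_or_frozen :
  (forall c, exists2 k, (k <= m)%N & 0 < colour_prob c k) ->
  not_absorbed m p g0 ->
  (exists t g, reachable t g /\ interior g) \/
  (exists i, [/\ p 0%N = 1, p m = 0, colour_deg g0 i true = 0%N &
     colour_deg g0 (other i) false = 0%N]).
Proof.
move=> both absorb; have [|none] := pselect (exists t g, reachable t g /\ interior g).
  by left.
right; have r0 := reachable0 hg0 hG.
pose c i := (0 < colour_deg g0 i true)%N.
have mono i : colour_deg g0 i (~~ c i) = 0%N.
  apply: contrapT => /eqP; rewrite -lt0n => ci; apply: none.
  apply: (mixed_interior (i := i) both r0) => b.
  by move: ci; rewrite /c; case: b; case: (posnP (colour_deg g0 i true)) => //= ->.
have pos i : (0 < colour_deg g0 i (c i))%N.
  have := community_deg0_gt0 hg0 i; rewrite /community_deg; have := mono i.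
  by case: (c i) => /= ->; rewrite ?addn0.
have stuck i : colour_prob (~~ c i) (if c (other i) then m else 0%N) <= 0.
  rewrite leNgt; apply/negP => hc; apply: none.
  have := pos (other i); case: (c (other i)) hc => hc co.
    have no_blue : (m < m)%N -> (0 < colour_deg g0 (other i) false)%N by rewrite ltnn.
    have [g1 [r1 c1 _ _]] := reachable_choice hm hmu_pos hG r0 (leqnn m) (fun=> co) no_blue hc.
    apply: (mixed_interior (i := i) both r1) => b; rewrite c1 addn_gt0.
    case: eqP => [_|]; first by rewrite muln1 hm orbT.
    by have := pos i; case: (c i); case: b => //= ->.
  have no_red : (0 < 0)%N -> (0 < colour_deg g0 (other i) true)%N by [].
  have [g1 [r1 c1 _ _]] := reachable_choice hm hmu_pos hG r0 (leq0n m) no_red (fun=> co) hc.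
  apply: (mixed_interior (i := i) both r1) => b; rewrite c1 addn_gt0.
  case: eqP => [_|]; first by rewrite muln1 hm orbT.
  by have := pos i; case: (c i); case: b => //= ->.
have seen (v : vertex g0) : c (community v) = is_red v.
  have : (0 < colour_deg g0 (community v) (is_red v))%N.
    rewrite /colour_deg /label_deg (bigD1 v) /=; last by rewrite /community /is_red -surjective_pairing.
    by rewrite addn_gt0 (initial_deg hg0).
  by have := mono (community v); case: (c _); case: (is_red v) => //= ->.
have p0 := hp (leq0n m); have pm := hp (leqnn m).
have frozen i : c i = false -> c (other i) = true ->
  exists i, [/\ p 0%N = 1, p m = 0, colour_deg g0 i true = 0%N &
     colour_deg g0 (other i) false = 0%N].
  move=> ci co; exists i; have := stuck i; have := stuck (other i).
  rewrite rev_ordK ci co /colour_prob /= => h1 h2.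
  split; [by lra|by lra|by have := mono i; rewrite ci|by have := mono (other i); rewrite co].
pose i0 : 'I_2 := ord0.
case c0 : (c i0); case c1 : (c (other i0)).
- have pm1 : p m = 1 by have := stuck i0; rewrite c0 c1 /colour_prob /=; lra.
  have [v] := absorb.2 pm1; rewrite -seen => /negP[].
  by move: (community v); apply: (other_ind (y := i0)).
- by apply: (frozen (other i0)); rewrite // rev_ordK.
- exact: (frozen i0).
- have p00 : p 0%N = 0 by have := stuck i0; rewrite c0 c1 /colour_prob /=; lra.
  have [v] := absorb.1 p00; rewrite -seen.
  by move: (community v); apply: (other_ind (y := i0)); rewrite ?c0 ?c1.
Qed.

Lemma frozen_limits i : p 0%N = 1 -> p m = 0 -> colour_deg g0 i true = 0%N ->
  colour_deg g0 (other i) false = 0%N ->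
  exists A : set T, [/\ measurable A, (0 < P A)%E & A `<=` [set x |
    Z (G t x) i @[t --> \oo] --> (0 : R) /\ Z (G t x) (other i) @[t --> \oo] --> (1 : R)]].
Proof.
move=> p0 pm ci co.
pose Inv t g := [/\ regular m g0 t g, colour_deg g i true = 0%N &
  colour_deg g (other i) false = 0%N].
pose good := fun (t : nat) (g : tgraph 2) => True.
exists [set x | forall s, (0 <= s)%N -> Inv s (G s x) /\ good s (G s x)]; split.
- exact: (measurable_path_event hG (leq 0) (fun s h => Inv s h /\ good s h)).
- apply: (stays_good_forever hmu_sum hG (Inv := Inv) (good := good)
    (f := fun _ _ => 0) _ _ _ _ _ (history0 hG)) => //.
  + move=> t g y w b [rg gi go] s0.
    have [rule hw] := step_prob_neq0 s0.
    have [c1 c2 c3] := colour_deg_regular_step rg s0.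
    have rg' : regular m g0 t.+1 (add_vertex y w b) by exact: regular_step s0.
    have colour v : v \in w -> (0 < colour_deg g (other y) (is_red v))%N.
      move=> /hw[cv dv]; rewrite /colour_deg /label_deg (bigD1 v) /=.
        by rewrite addn_gt0 dv.
      by rewrite -cv /community /is_red -surjective_pairing.
    have [yi|] := eqVneq y i.
      have cw : count (@is_red 2 g) w = m.
        rewrite -[RHS](size_tuple w); apply/eqP; rewrite -all_count; apply/allP => v /colour.
        by rewrite yi; case: (is_red v) => //; rewrite go.
      have b0 : b = false.
        by apply/negP => bt; move: rule; rewrite bt cw pm eqxx.
      split=> //; first by rewrite -yi c1 yi gi b0 muln0.
      by rewrite -yi c3 yi go cw subnn.
    rewrite neq_other => /eqP yo.
    have cw : count (@is_red 2 g) w = 0%N.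
      apply/eqP; rewrite -leqn0 leqNgt -has_count; apply/hasPn => v /colour.
      by rewrite yo rev_ordK; case: (is_red v) => //; rewrite gi.
    have b1 : b = true.
      by apply/negPn/negP => /negbTE bf; move: rule; rewrite bf cw p0 subrr eqxx.
    split=> //; first by rewrite -[i]rev_ordK -yo c2 yo rev_ordK gi cw.
    by rewrite -yo c1 yo go b1 muln0.
  + by move=> t g [rg _ _]; exact: regular_deg_gt0 rg.
  + by move=> t g _; case.
  + by move=> t g [rg _ _] _; rewrite mean_step_cst //; exact: regular_deg_gt0 rg.
  + by split=> //; exact: regular0.
  + by rewrite probability_setT lte01.
move=> x hx; split.
  rewrite (_ : (fun t => Z (G t x) i) = fun=> 0); first exact: cvg_cst.
  apply/funext => t; have [[_ gi _] _] := hx t isT.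
  by rewrite red_proportionE gi mul0r.
rewrite (_ : (fun t => Z (G t x) (other i)) = fun=> 1); first exact: cvg_cst.
apply/funext => t; have [[rg _ go] _] := hx t isT.
have := regular_deg_gt0 hg0 rg (other i).
by rewrite red_proportionE /community_deg go addn0 => tpos; rewrite divff // pnatr_eq0 -lt0n.
Qed.
End Start.

(** The derivative of [f o f] at a fixed point of [f] is the square of that of
    [f], which is incompatible with linear instability there. *)
Lemma two_cycle_of_stable (R : realType) (f : {poly R}) (zs zt : R) :
  essentially_unique_fixed_point f zs -> zt <> zs ->
  linearly_stable (f \Po f) zt ->
  [/\ 0 <= zt <= 1, f.[f.[zt]] = zt, f.[zt] <> zt & f^`().[f.[zt]] * f^`().[zt] < 1].
Proof.
move=> [_ huniq] zts [[[zt01 fix2] _]].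
rewrite deriv_comp hornerM horner_comp => d1.
rewrite horner_comp in fix2; split=> // fz.
have [_ [_ d2]] := huniq _ (conj zt01 fz) zts.
by move: d1; rewrite fz; nra.
Qed.

Theorem theorem3p6 (R : realType) (m : nat) (hm : (1 <= m)%N)
    (p : nat -> R) (hp : forall k, (k <= m)%N -> 0 <= p k <= 1)
    (zstar : R)
    (hzstar : essentially_unique_fixed_point (rule_poly m p) zstar)
    (ztilde : R) (hztilde_neq : ztilde <> zstar)
    (hztilde : linearly_stable (rule_poly m p \Po rule_poly m p) ztilde)
    (mu : 'I_2 -> R) (hmu_pos : forall i, 0 < mu i)
    (hmu_sum : \sum_i mu i = 1)
    (g0 : tgraph 2) (hg0 : initial_graph m g0) (hg0' : not_absorbed m p g0)
    (d : measure_display) (T : measurableType d) (P : probability T R)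
    (G : nat -> T -> tgraph 2)
    (hG : attachment_process P (\matrix_(x < 2, y < 2) (x != y)%:R)
            mu m p g0 G) :
  let E := [set x : T | exists z1 z2 : R, [/\ z1 <> z2,
      (fun t : nat => red_proportion R (G t x) ord0) @ \oo --> z1 &
      (fun t : nat => red_proportion R (G t x) ord_max) @ \oo --> z2]] in
  measurable E /\ (0 < P E)%E.
Proof.
move=> E.
have mE : measurable E.
  apply: (@measurable_distinct_limits R _ _ (tgraph 2) G
    (fun g => red_proportion R g ord0) (fun g => red_proportion R g ord_max)).
  exact: process_measurable hG.
split=> //.
have omax : ord_max = other ord0 :> 'I_2 by apply: val_inj.
suff [A [mA PA AE]] : exists A : set T, [/\ measurable A, (0 < P A)%E & A `<=` E].
  by apply: lt_le_trans PA _; apply: le_measure; rewrite ?inE.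
have [zt01 cyc nfix dlt] := two_cycle_of_stable hzstar hztilde_neq hztilde.
set f := rule_poly m p in cyc nfix dlt.
(* A rule producing a single colour has a constant polynomial, and then the
   cycle would be a fixed point. *)
have both c : exists2 k, (k <= m)%N & 0 < (if c then p k else 1 - p k).
  apply: contrapT => no; apply: nfix.
  have pc k : (k <= m)%N -> p k = (~~ c)%:R.
    move=> km; have /andP[p0 p1] := hp k km; apply: contrapT => pk; apply: no; exists k => //.
    case: c pk => /= pk; rewrite ?subr_gt0 lt_neqAle ?p0 ?p1 andbT; apply/eqP.
      by move=> /esym.
    by [].
  have fE z : f.[z] = (~~ c)%:R.
    rewrite -[RHS](rule_poly_cst m _ z) /f !horner_rule_poly.
    by apply: eq_bigr => k _; rewrite pc // -ltnS.
  by rewrite -[in RHS]cyc !fE.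
have [[t [g [rg ig]]]|[i [p0 pm ci co]]] :=
  interior_or_frozen hm hp hmu_pos hg0 hG both hg0'; last first.
  have [A [mA PA AZ]] := frozen_limits hm hmu_sum hg0 hG p0 pm ci co.
  exists A; split=> // x /AZ /= [Z0 Z1]; rewrite /E /= omax.
  have [i0|] := eqVneq i ord0.
    exists 0, 1; rewrite i0 in Z0 Z1; split=> //; apply/eqP; rewrite eq_sym; exact: oner_neq0.
  rewrite neq_other => /eqP io; rewrite io rev_ordK in Z0 Z1.
  by exists 1, 0; split=> //; apply/eqP; exact: oner_neq0.
pose a (i : 'I_2) := if i == ord0 then f.[ztilde] else ztilde.
have a0 : a ord0 = f.[ztilde] by rewrite /a eqxx.
have a1 : a (other ord0) = ztilde by rewrite /a (negbTE (other_neq _)).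
have a01 i : 0 <= a i <= 1.
  by move: i; apply: (other_ind (y := ord0)); rewrite ?a0 ?a1 // rule_poly_itv.
have fa i : f.[a (other i)] = a i.
  by move: i; apply: (other_ind (y := ord0)); rewrite ?rev_ordK a0 a1.
have da i : f^`().[a (other i)] * f^`().[a i] < 1.
  move: i; apply: (other_ind (y := ord0)); rewrite ?rev_ordK a0 a1 //.
  by rewrite mulrC.
have [q [kap [eps [C [q0 kap0 eps0 C0 hV]]]]] :=
  lyapunov_contraction hm hp hmu_pos hmu_sum hg0 a01 fa da.
have C80 : 0 <= 8 * C by rewrite mulr_ge0.
have near := reachable_near hm hp hmu_pos hG a01 fa q0 C80 eps0 rg ig.
have [A [mA PA AZ]] := local_convergence hm hp hmu_pos hmu_sum hg0 hG q0 kap0 eps0 C0 hV near.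
exists A; split=> // x /AZ Zx; exists (a ord0), (a ord_max); split.
- by rewrite omax a0 a1.
- exact: Zx.
- exact: Zx.
Qed.
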